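(* Let $G$ be a $3$-connected graph. Then $G$ is ASP if and only if one of the following conditions is satisfied: (1) $|V(G)|\le 6$ (in which case $2\le\chi(G)\le 6$); (2) $K_{3,r}\subseteq G\subseteq D_r$ for some $r\ge 4$ (in which case $2\le\chi(G)\le 4$); (3) $G\cong W_r$ for some $r\ge 6$ (in which case $3\le\chi(G)\le 4$); (4) $G$ is truncated cubic (in which case $\chi(G)=3$).
   Context: Graphs are finite, simple and undirected. $\chi$ denotes the chromatic number. $P_k$ is the path on $k$ vertices. For a graph $H$, the skeleton of $H$ is its subgraph induced by (i.e. consisting of) the edges of $H$ both of whose ends have degree at least $3$ in $H$. For a graph $S$, $K_4\langle S\rangle$ denotes any subdivision of $K_4$ whose skeleton is isomorphic to $S$ (equivalently: exactly the edges of $K_4$ forming a copy of $S$ are left unsubdivided, and every other edge is subdivided at least once). A graph is ASP (almost series-parallel) if it contains no $K_4\langle P_3\rangle$ and no $K_4\langle P_4\rangle$ as a subgraph. $D_r$ denotes the graph obtained from $K_{3,r}$ by adding the three edges of a triangle on the part of size $3$. $W_r$ is the $r$-wheel: a circuit (cycle) of length $r$ together with one further vertex adjacent to all vertices of the circuit. A cubic ($3$-regular) graph is truncated cubic if each of its vertices belongs to precisely one triangle. *)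

(* Defs.v *)
From mathcomp Require Import all_boot.

Set Implicit Arguments.
Unset Strict Implicit.
Unset Printing Implicit Defensive.

Record sgraph := SGraph {
  vertex :> finType;
  adj : rel vertex;
  adj_sym : symmetric adj;
  adj_irrefl : irreflexive adj }.

Notation "x -- y" := (adj x y) (at level 30).

Section Notions.

Implicit Types G H J S : sgraph.

Definition isomorphic G H : Prop :=
  exists2 f : G -> H, bijective f & forall x y, f x -- f y = x -- y.

(* Containment up to isomorphism, not necessarily as an induced subgraph. *)
Definition subgraph H G : Prop :=
  exists2 f : H -> G, injective f & forall x y, x -- y -> f x -- f y.

Definition degree G (x : G) : nat := #|[set y | x -- y]|.

Definition k_connected (k : nat) G : Prop :=
  k < #|G| /\
  forall A : {set G}, #|A| < k ->
    forall x y : G, x \notin A -> y \notin A ->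
      connect [rel u v | [&& u \notin A, v \notin A & u -- v]] x y.

Definition colorable G (k : nat) : bool :=
  [exists f : {ffun G -> 'I_k}, forall x, forall y, x -- y ==> (f x != f y)].

Lemma colorable_card G : colorable G #|G|.
Proof.
apply/existsP; exists [ffun x => enum_rank x].
apply/forallP => x; apply/forallP => y; apply/implyP => xy.
rewrite !ffunE; apply: contraTneq xy => /enum_rank_inj ->.
by rewrite adj_irrefl.
Qed.

Definition chi G : nat := ex_minn (ex_intro (colorable G) _ (colorable_card G)).

(* [b x] is the branch vertex of [x] and [p x y] lists, from [b x] to [b y],  *)
(* the vertices inserted on the edge [x -- y]. The last two clauses say that  *)
(* [H] has no vertex and no edge besides those of the subdivided edges.       *)
Definition subdivision_of J H : Prop :=
  exists (b : J -> H) (p : J -> J -> seq H),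
    let walk x y := b x :: rcons (p x y) (b y) in
    [/\ injective b,
        forall x y, x -- y ->
          [/\ sorted (@adj H) (walk x y), uniq (walk x y),
              p y x = rev (p x y) & forall z, b z \notin p x y],
        forall x y x' y' u, x -- y -> x' -- y' ->
          u \in p x y -> u \in p x' y' -> [set x; y] = [set x'; y'],
        forall u, (exists x, u = b x) \/ (exists x y, x -- y /\ u \in p x y)
      & forall u v, u -- v ->
          exists x y, x -- y /\ infix [:: u; v] (walk x y)].

Section Skeleton.
Variable H : sgraph.

Definition skel_edge : rel H :=
  [rel x y | [&& x -- y, 3 <= degree x & 3 <= degree y]].

Definition skel_vertex := {x : H | [exists y, skel_edge x y]}.

Definition skel_adj : rel skel_vertex := [rel x y | skel_edge (val x) (val y)].

Fact skel_adj_sym : symmetric skel_adj.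
Proof.
by move=> x y; rewrite /skel_adj /skel_edge /= adj_sym [X in _ && X]andbC.
Qed.

Fact skel_adj_irrefl : irreflexive skel_adj.
Proof. by move=> x; rewrite /skel_adj /skel_edge /= adj_irrefl. Qed.

Definition skeleton : sgraph := SGraph skel_adj_sym skel_adj_irrefl.

End Skeleton.

End Notions.

Definition complete_adj n : rel 'I_n := [rel x y | x != y].
Fact complete_sym n : symmetric (@complete_adj n).
Proof. by move=> x y; rewrite /complete_adj /= eq_sym. Qed.
Fact complete_irrefl n : irreflexive (@complete_adj n).
Proof. by move=> x; rewrite /complete_adj /= eqxx. Qed.
Definition complete n : sgraph := SGraph (@complete_sym n) (@complete_irrefl n).

(* The path on [n] vertices (so with [n.-1] edges). *)
Definition pathg_adj n : rel 'I_n :=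
  [rel x y : 'I_n | (x.+1 == y) || (y.+1 == x)].
Fact pathg_sym n : symmetric (@pathg_adj n).
Proof. by move=> x y; rewrite /pathg_adj /= orbC. Qed.
Fact pathg_irrefl n : irreflexive (@pathg_adj n).
Proof. by move=> x; rewrite /pathg_adj /= gtn_eqF. Qed.
Definition pathg n : sgraph := SGraph (@pathg_sym n) (@pathg_irrefl n).

Definition K4sub (S H : sgraph) : Prop :=
  subdivision_of (complete 4) H /\ isomorphic (skeleton H) S.

Definition ASP (G : sgraph) : Prop :=
  forall H : sgraph, K4sub (pathg 3) H \/ K4sub (pathg 4) H -> ~ subgraph H G.

Definition K3_adj r : rel ('I_3 + 'I_r) :=
  fun x y => match x, y with
  | inl _, inr _ | inr _, inl _ => true
  | _, _ => false
  end.
Fact K3_sym r : symmetric (@K3_adj r). Proof. by case=> i []. Qed.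
Fact K3_irrefl r : irreflexive (@K3_adj r). Proof. by case. Qed.
Definition K3 r : sgraph := SGraph (@K3_sym r) (@K3_irrefl r).

Definition D_adj r : rel ('I_3 + 'I_r) :=
  fun x y => match x, y with
  | inl i, inl j => i != j
  | _, _ => K3_adj x y
  end.
Fact D_sym r : symmetric (@D_adj r).
Proof. by case=> i [] j //=; rewrite eq_sym. Qed.
Fact D_irrefl r : irreflexive (@D_adj r).
Proof. by case=> i //=; rewrite eqxx. Qed.
Definition D r : sgraph := SGraph (@D_sym r) (@D_irrefl r).

(* [None] is the hub; the rim is a circuit only for [3 <= r]. *)
Definition wheel_adj r : rel (option 'I_r) :=
  fun x y => match x, y with
  | Some i, Some j => (i != j) && ((j == ordS i) || (i == ordS j))
  | None, None => false
  | _, _ => true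
  end.
Fact wheel_sym r : symmetric (@wheel_adj r).
Proof. by case=> [i|] [j|] //=; rewrite eq_sym orbC. Qed.
Fact wheel_irrefl r : irreflexive (@wheel_adj r).
Proof. by case=> [i|] //=; rewrite eqxx. Qed.
Definition wheel r : sgraph := SGraph (@wheel_sym r) (@wheel_irrefl r).

Definition triangle (G : sgraph) (T : {set G}) : bool :=
  (#|T| == 3) && [forall x in T, forall y in T, (x != y) ==> x -- y].

Definition cubic (G : sgraph) : Prop := forall x : G, degree x = 3.

Definition truncated_cubic (G : sgraph) : Prop :=
  cubic G /\ forall x : G, #|[set T : {set G} | triangle T & x \in T]| = 1.

(* Main.v *)
Require Import Defs.
From mathcomp Require Import all_boot zify.

(** Why the theorem holds.

    Both forbidden graphs have branch vertices a, b, c, d such that ab and bc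
    are edges, the connections ac and bd and at least one of ad and cd are
    subdivided, and the last connection is arbitrary.  Conversely every
    subdivision of K4 of this shape is one of the two.  So an ASP graph is one
    in which no vertex b off a circuit through a, c, d is adjacent to a and c
    and has a link of length at least two to d, where a and c are not adjacent
    on the circuit and d is not adjacent on it to both [asp_forbids].

    Let G be 3-connected and ASP with at least seven vertices.

    - If three vertices of G lie in distinct components of G - X with |X| = 3,
      then no edge avoids X, so that every vertex off X is adjacent to all of X
      and G lies between K_{3,r} and D_r [separated_K3r].  From now on assume
      that this does not happen.

    - Every vertex b has a circuit in G - b through all its neighbours
      [circuit_thru_nbrs].  Take a circuit with as many neighbours as possible;
      a neighbour u off it has a fan to two vertices p, q of the circuit, both
      arcs between p and q contain neighbours by maximality, and the forbidden
      shape leaves only the possibility that {p, q, b} separates u from the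
      two arcs and the arcs from each other.

    - Such a circuit with a link R across it is a theta graph, and the forbidden
      shape then says that two neighbours of b on one side of R are consecutive,
      up to one tight exception [theta_cross].  If deg b = 3 and the neighbours
      of b are pairwise nonadjacent, no link joins two open arcs between them;
      so N(b) separates b and those arcs, which was excluded
      [degree3_independent].

    - If deg b >= 4, a vertex of the circuit not adjacent to b forces
      deg b = 4 and a graph with six vertices [arc_forces_four],
      [arc_forces_tripod], [four_rim_small].  So every circuit through N(b)
      consists of N(b); then nothing lies off it, it has no chord, and G is a
      wheel with hub b [hub_wheel].

    - If every degree is 3, every vertex lies in a triangle, and only in one,
      because two triangles sharing an edge would leave a cut of size two
      [cubic_truncated].

    For the converse, a subdivision of K4 has four vertices of degree at least
    three and otherwise vertices of degree at most two, and its skeleton is a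
    path; these facts alone keep the forbidden graphs out of D_r and of wheels
    and force at least seven vertices.  In a truncated cubic graph a branch
    vertex with two branch neighbours would have a triangle inside the
    subdivision.  The only chromatic number that is not read off from an
    explicit colouring is that of truncated cubic graphs, which follows from
    the argument for the theorem of Brooks [cubic_3colorable]. *)

Set Implicit Arguments.
Unset Strict Implicit.
Unset Printing Implicit Defensive.

Local Arguments uniq {T} s : simpl never.

(** * Links, bridges and fans *)

(** Disjointness of several lists is one [uniq] statement about their concatenation;
    counting occurrences reduces the rearrangements of such statements to linear arithmetic. *)
Lemma uniq_countP (T : eqType) (s : seq T) :
  reflect (forall x, count_mem x s <= 1) (uniq s).
Proof.
apply: (iffP idP) => [us x|]; first by rewrite count_uniq_mem //; case: (_ \in _).
elim: s => //= x s IHs le1; rewrite cons_uniq; apply/andP; split.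
  by apply/count_memPn/eqP; have := le1 x; rewrite eqxx; lia.
by apply: IHs => y; have := le1 y; lia.
Qed.

Lemma count_rcons (T : eqType) (a : pred T) s x : count a (rcons s x) = a x + count a s.
Proof. by rewrite -cats1 count_cat /= addn0 addnC. Qed.

Lemma count_cons (T : eqType) (a : pred T) s x : count a (x :: s) = a x + count a s.
Proof. by []. Qed.

Ltac count_goal :=
  rewrite ?(count_cat, count_rev, count_rcons, count_cons) /=; clear; lia.

Tactic Notation "ucount" hyp(H) :=
  apply/uniq_countP; let u := fresh "u" in intro u; move: (elimT (uniq_countP _) H u);
  count_goal.

Section Links.
Variable G : sgraph.
Implicit Types (x y z : G).

(** A path from [x] to [y] given by its interior [s], so that links with common ends are
    internally disjoint exactly when their interiors are disjoint lists. *)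
Definition link x s y := path (@adj G) x (rcons s y).

Lemma link_nil x y : link x [::] y = x -- y.
Proof. by rewrite /link /= andbT. Qed.

Lemma link_cons x y s z : link x (y :: s) z = x -- y && link y s z.
Proof. by []. Qed.

Lemma link_cat x s y t z : link x (s ++ y :: t) z = link x s y && link y t z.
Proof. by rewrite /link rcons_cat -cat_rcons cat_path last_rcons. Qed.

Lemma link_rev x s y : link x (rev s) y = link y s x.
Proof.
rewrite /link -rev_cons -(belast_rcons y s x) -{1}(last_rcons y s x) rev_path.
by apply: eq_path => u v; rewrite /= adj_sym.
Qed.

(** Cut the link at its last vertex in [S] and then at the next vertex in [T], after
    removing loops. *)
Lemma link_bridge (S T : pred G) x s y :
    link x s y -> S x -> T y -> (forall z, S z -> ~~ T z) ->
  exists p r q, [/\ S p, T q, link p r q, uniq (p :: q :: r) &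
    [/\ p \in x :: s, q \in rcons s y &
     forall z, z \in r -> [&& ~~ S z, ~~ T z & z \in s]]].
Proof.
move=> Ls Sx Ty dST.
have [t [Lt Ut sub_t]] : exists t, [/\ link x t y, uniq (x :: y :: t) & {subset t <= s}].
  move: Ls (last_rcons x s y); rewrite /link => /shortenP[p' Pp' Up' sub].
  case/lastP: p' Pp' Up' sub => [|t z] Pt Ut sub; first by move=> /= xy; have := dST _ Sx;
    rewrite xy Ty.
  rewrite last_rcons => zy; subst z; exists t; split=> //.
    by ucount Ut.
  move=> z zt; have := sub z; rewrite !mem_rcons !inE zt orbT => /(_ isT) /orP[/eqP zy|//].
  by subst z; move: Ut; rewrite cons_uniq rcons_uniq zt /= andbF.
suff [p [r [q [Sp Tq Lr Ur [pE qE rE]]]]] : exists p r q, [/\ S p, T q, link p r q,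
  uniq (p :: q :: r) &
    [/\ p \in x :: t, q \in rcons t y &
     forall z, z \in r -> [&& ~~ S z, ~~ T z & z \in t]]].
  exists p, r, q; split=> //; split.
  - by move: pE; rewrite !inE => /orP[->//|/sub_t->]; rewrite orbT.
  - by move: qE; rewrite !mem_rcons !inE => /orP[->//|/sub_t->]; rewrite orbT.
  - by move=> z /rE /and3P[-> -> /sub_t].
clear Ls s sub_t.
have [n] := ubnP (size t); elim: n t x y Lt Ut Sx Ty => // n IHn t x y Lt Ut Sx Ty.
case: (boolP (has S t)) => [/hasP[z zt Sz]|noS].
  case/splitPr: zt Lt Ut => t1 t2; rewrite link_cat size_cat /= => /andP[_ L2] Ut lt_n.
  have [||p [r [q [Sp Tq Lr Ur [pE qE rE]]]]] := IHn t2 z y L2 _ Sz Ty.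
  - by ucount Ut.
  - lia.
  exists p, r, q; split=> //; split=> [||u /rE /and3P[-> -> u2]].
  - by rewrite !inE mem_cat pE !orbT.
  - by rewrite rcons_cat mem_cat rcons_cons inE qE !orbT.
  - by rewrite mem_cat inE u2 !orbT.
case: (boolP (has T t)) => [/hasP[z zt Tz]|noT].
  case/splitPr: zt Lt Ut noS => t1 t2; rewrite link_cat size_cat /= => /andP[L1 _] Ut _ lt_n.
  have [||p [r [q [Sp Tq Lr Ur [pE qE rE]]]]] := IHn t1 x z L1 _ Sx Tz.
  - by ucount Ut.
  - lia.
  exists p, r, q; split=> //; split=> [||u /rE /and3P[-> -> u2]].
  - by move: pE; rewrite !inE mem_cat => /orP[->//|->]; rewrite !orbT.
  - by move: qE; rewrite !mem_rcons !inE mem_cat inE => /orP[->|->]; rewrite !orbT.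
  - by rewrite mem_cat u2.
move=> _; exists x, t, y; split=> //; split; rewrite ?mem_rcons ?mem_head // => z zt.
by rewrite zt andbT (hasPn noS) // (hasPn noT).
Qed.

Definition avoid (A : {set G}) : rel G := [rel u v | [&& u \notin A, v \notin A & u -- v]].

Lemma connect_bridge (A : {set G}) (S T : pred G) x y :
    connect (avoid A) x y -> S x -> T y -> x \notin A -> (forall z, S z -> ~~ T z) ->
  exists p r q, [/\ S p, T q, link p r q, uniq (p :: q :: r) &
    [/\ p \notin A, q \notin A &
     forall z, z \in r -> [&& ~~ S z, ~~ T z & z \notin A]]].
Proof.
move=> /connectP[s Ps yE] Sx Ty xA dST.
have sA : all (fun z => z \notin A) (x :: s).
  rewrite /= xA /=; elim: s x {yE Sx} xA Ps => //= z s IHs x xA /andP[/and3P[_ zA _] Ps];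
    rewrite zA /=; exact: IHs Ps.
have {}Ps : path (@adj G) x s by apply: sub_path Ps => u v /and3P[].
case/lastP: s yE sA Ps => [/= yx|s z]; first by have := dST _ Sx; rewrite -yx Ty.
rewrite last_rcons => <- sA Ps.
have [p [r [q [Sp Tq Lr Ur [pE qE rE]]]]] := link_bridge Ps Sx Ty dST.
exists p, r, q; split=> //; split.
- by apply: (allP sA); move: pE; rewrite !inE mem_rcons inE => /orP[->|->]; rewrite ?orbT.
- by apply: (allP sA); rewrite inE qE orbT.
- move=> u /rE /and3P[-> -> us]; apply: (allP sA).
  by rewrite inE mem_rcons inE us !orbT.
Qed.

Lemma bridge3 (A : {set G}) (S T : pred G) x y :
    k_connected 3 G -> #|A| < 3 -> S x -> T y -> x \notin A -> y \notin A ->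
    (forall z, S z -> ~~ T z) ->
  exists p r q, [/\ S p, T q, link p r q, uniq (p :: q :: r) &
    [/\ p \notin A, q \notin A &
     forall z, z \in r -> [&& ~~ S z, ~~ T z & z \notin A]]].
Proof.
move=> [_ G3] A3 Sx Ty xA yA dST.
exact: connect_bridge (G3 _ A3 _ _ xA yA) Sx Ty xA dST.
Qed.

(** Menger's theorem for two legs, with a prescribed target set for each: links to the two
    sets give a stem with a fork, and the stem shrinks as long as it is not reduced to [v]. *)
Lemma fan (I : {set G}) v (T1 T2 : pred G) :
    v \in I -> (forall z, z \in I -> ~~ (T1 z || T2 z)) ->
    (exists s t, [/\ T1 t, link v s t & {subset s <= I}]) ->
    (exists s t, [/\ T2 t, link v s t & {subset s <= I}]) ->
    (forall w, w \in I -> w != v ->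
       exists s t, [/\ T1 t || T2 t, link v s t, {subset s <= I} & w \notin s]) ->
  exists s1 t1 s2 t2, [/\ T1 t1, T2 t2, link v s1 t1, link v s2 t2 &
    [/\ {subset s1 <= I}, {subset s2 <= I} & uniq (v :: s1 ++ s2)]].
Proof.
move=> vI IT [s1 [t1 [Tt1 L1 s1I]]] [s2 [t2 [Tt2 L2 s2I]]] sep.
(* A stem [st] from [v] to a fork with disjoint links to both targets.  As the fork does not
   separate [v] from the targets, a link leaves the stem earlier and shortens it. *)
suff main n : forall (st q1 : seq G) (u1 : G) (q2 : seq G) (u2 : G), size st < n ->
    path (@adj G) v st -> {subset st <= I} -> {subset q1 <= I} -> {subset q2 <= I} ->
    T1 u1 -> T2 u2 -> link (last v st) q1 u1 -> link (last v st) q2 u2 ->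
    uniq (v :: st ++ q1 ++ q2) ->
  exists s1 t1 s2 t2, [/\ T1 t1, T2 t2, link v s1 t1, link v s2 t2 &
    [/\ {subset s1 <= I}, {subset s2 <= I} & uniq (v :: s1 ++ s2)]].
  have dv1 z : pred1 v z -> ~~ T1 z by move=> /eqP->; have := IT _ vI; rewrite negb_or =>
    /andP[].
  have [p [q1 [u1 [/eqP-> Tu1 Lq1 Uq1 [_ _ q1E]]]]] := link_bridge (S := pred1 v) L1 (eqxx v)
    Tt1 dv1.
  have dq1 z : z \in v :: q1 -> ~~ T2 z.
    move=> zq; have /IT : z \in I; last by rewrite negb_or => /andP[].
    by move: zq; rewrite inE => /predU1P[->//|/q1E/and3P[_ _ /s1I]].
  have [p' [r [u2 [p'q Tu2 Lr Ur [_ _ rE]]]]] := link_bridge (S := fun z =>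
    z \in v :: q1) L2 (mem_head v q1) Tt2 dq1.
  case/splitPl: p'q Lq1 Uq1 q1E rE dq1 => a b lastE Lq1 Uq1 q1E rE dq1.
  have abI : {subset a ++ b <= I} by move=> z /q1E /and3P[_ _ /s1I].
  apply: (main (size a).+1 a b u1 r u2) => //.
  - by move: Lq1; rewrite /link rcons_cat cat_path => /andP[].
  - by move=> z za; apply: abI; rewrite mem_cat za.
  - by move=> z za; apply: abI; rewrite mem_cat za orbT.
  - by move=> z /rE /and3P[_ _ /s2I].
  - by move: Lq1; rewrite /link rcons_cat cat_path => /andP[].
  - by rewrite lastE.
  - have {rE} : uniq (r ++ v :: a ++ b).
      rewrite cat_uniq; apply/and3P; split.
      + by move: Ur; rewrite !cons_uniq => /and3P[].
      + by apply/hasPn => z zab; apply/negP => /rE /and3P[]; rewrite zab.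
      + by move: Uq1; rewrite !cons_uniq !inE negb_or => /and3P[/andP[_ ->] _ ->].
    by move=> U; ucount U.
elim: n => // n IHn st q1 u1 q2 u2; case/lastP: st => [|st y].
  move=> _ _ _ q1I q2I Tu1 Tu2 Lq1 Lq2 Uq.
  by exists q1, u1, q2, u2.
rewrite size_rcons last_rcons ltnS => lt_n Pst stI q1I q2I Tu1 Tu2 Lq1 Lq2 Uq.
have yI : y \in I by apply: stI; rewrite mem_rcons mem_head.
have yv : y != v.
  by apply: contraTneq Uq => ->; rewrite cons_uniq mem_cat mem_rcons mem_head.
have [s [t [Tt Ls sI ys]]] := sep y yI yv.
pose S := [pred z | z \in v :: st].
pose T := [pred z | [|| z \in q1, z \in q2, T1 z | T2 z]].
have stI' z : z \in v :: st -> z \in I.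
  by rewrite inE => /predU1P[->//|zs]; apply: stI; rewrite mem_rcons inE zs orbT.
have dST z : S z -> ~~ T z.
  move=> zS; rewrite /T /= negb_or negb_or (IT _ (stI' _ zS)).
  move/uniq_countP/(_ z): Uq; move: zS; rewrite /S /= -!has_pred1 !has_count.
  rewrite !count_cat count_rcons /=; clear; lia.
have [|p [r [q [pS Tq Lr Ur [_ qs rE]]]]] := link_bridge (S := S) (T := T) Ls (mem_head _ _) _
  dST.
  by rewrite /T /=; case/orP: Tt => ->; rewrite ?orbT.
have ry : y \notin r by apply: contra ys => /rE /and3P[].
have qy : y != q.
  apply: contraNneq ys => yq; move: qs; rewrite -yq mem_rcons inE => /predU1P[yt|//].
  by move: Tt; rewrite -yt (negbTE (IT _ yI)).
have rI : {subset r <= I} by move=> z /rE /and3P[_ _ /sI].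
have Ur' : uniq (r ++ v :: rcons st y ++ q1 ++ q2).
  rewrite cat_uniq Uq andbT; apply/andP; split; first by move: Ur; rewrite !cons_uniq =>
    /and3P[].
  apply/hasPn => z; apply: contraL => /= zr; have /and3P[zS zT _] := rE _ zr.
  move: zS zT; rewrite /S /T /= !inE mem_cat mem_rcons inE mem_cat !negb_or.
  move=> /andP[-> ->] /and4P[-> -> _ _]; rewrite andbT /=.
  by rewrite andbT; apply: contraNneq ry => <-.
rewrite /S /= in pS; case/splitPl: pS lt_n Pst stI Uq Ur' {S dST rE stI'} => a b pE.
rewrite rcons_cat cat_path pE => lt_n /andP[Pa Lb] stI Uq Ur'.
have aI : {subset a <= I} by move=> z za; apply: stI; rewrite mem_cat za.
have bI : {subset b <= I} by move=> z zb; apply: stI; rewrite mem_cat mem_rcons inE zb !orbT.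
have byI s' : {subset s' <= I} -> {subset b ++ y :: s' <= I}.
  by move=> s'I z; rewrite mem_cat inE => /or3P[/bI|/eqP->|/s'I].
have a_n : size a < n by apply: leq_ltn_trans lt_n; rewrite size_cat leq_addr.
have catI s' z t' : {subset s' ++ z :: t' <= I} -> {subset r ++ z :: t' <= I}.
  move=> h u; rewrite mem_cat => /orP[/rI//|ut]; apply: h; by rewrite mem_cat ut orbT.
(* The new link ends on one of the two prongs, whose remainder it takes over, or on a target. *)
case/or4P: Tq => Tq.
- case/splitPr: Tq Lq1 q1I Ur' Uq => c d; rewrite link_cat => /andP[_ Ld] q1I Ur' Uq.
  apply: (IHn a (r ++ q :: d) u1 (b ++ y :: q2) u2) => //.
  + exact: catI q1I.
  + exact: byI.
  + by rewrite pE link_cat Lr.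
  + by rewrite pE link_cat Lq2 andbT.
  + by ucount Ur'.
- case/splitPr: Tq Lq2 q2I Ur' Uq => c d; rewrite link_cat => /andP[_ Ld] q2I Ur' Uq.
  apply: (IHn a (b ++ y :: q1) u1 (r ++ q :: d) u2) => //.
  + exact: byI.
  + exact: catI q2I.
  + by rewrite pE link_cat Lq1 andbT.
  + by rewrite pE link_cat Lr.
  + by ucount Ur'.
- apply: (IHn a r q (b ++ y :: q2) u2) => //.
  + exact: byI.
  + by rewrite pE.
  + by rewrite pE link_cat Lq2 andbT.
  + by ucount Ur'.
- apply: (IHn a (b ++ y :: q1) u1 r q) => //.
  + exact: byI.
  + by rewrite pE link_cat Lq1 andbT.
  + by rewrite pE.
  + by ucount Ur'.
Qed.

End Links.

(** * Degrees in a subdivision of K4 *)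

Lemma set2_eq (T : finType) (x y x' y' : T) :
  [set x; y] = [set x'; y'] -> (x = x' /\ y = y') \/ (x = y' /\ y = x').
Proof.
move=> E.
have : x \in [set x'; y'] by rewrite -E !inE eqxx.
have : y \in [set x'; y'] by rewrite -E !inE eqxx orbT.
have : x' \in [set x; y] by rewrite E !inE eqxx.
have : y' \in [set x; y] by rewrite E !inE eqxx orbT.
rewrite !inE => /orP[]/eqP h1 /orP[]/eqP h2 /orP[]/eqP h3 /orP[]/eqP h4;
  by [left; split; congruence | right; split; congruence].
Qed.

Lemma infix2_nth (T : eqType) (x0 u v : T) s : uniq s -> infix [:: u; v] s ->
  v = nth x0 s (index u s).+1 /\ u = nth x0 s (index v s).-1.
Proof.
move=> U /infixP[s1 [s2 E]].
have /negbTE nu : u \notin s1.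
  by apply: contraTN U => us; rewrite E cat_uniq /= us !andbF.
have /negbTE nv : v \notin s1.
  by apply: contraTN U => vs; rewrite E cat_uniq /= vs orbT !andbF.
have uv : (u == v) = false.
  by apply: contraTF U => /eqP uv; rewrite E uv cat_uniq cons_uniq mem_head !andbF.
rewrite E !index_cat nu nv /= uv !eqxx /= !inE !eqxx orbT /= addn0 addn1.
by rewrite !nth_cat /= ltnn ltnNge leqnSn /= subSnn subnn.
Qed.

Section Subdivision.
Variables (H : sgraph) (b : 'I_4 -> H) (p : 'I_4 -> 'I_4 -> seq H).
Let w i j := b i :: rcons (p i j) (b j).
Hypothesis b_inj : injective b.
Hypothesis pP : forall i j, i != j ->
  [/\ sorted (@adj H) (w i j), uniq (w i j), p j i = rev (p i j) & forall k, b k \notin p i j].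
Hypothesis p_disj : forall i j i' j' u, i != j -> i' != j' ->
  u \in p i j -> u \in p i' j' -> [set i; j] = [set i'; j'].
Hypothesis cover : forall u, (exists i, u = b i) \/ (exists i j, i != j /\ u \in p i j).
Hypothesis edges : forall u v, u -- v -> exists i j, i != j /\ infix [:: u; v] (w i j).

Lemma branch_degree i : 3 <= degree (b i).
Proof.
pose h j := head (b j) (p i j).
have hP j : j != i -> b i -- h j.
  rewrite eq_sym => /pP[]; rewrite /h /w; case: (p i j) => [|x s] /= /andP[] //.
have h_inj : {in [set~ i] &, injective h}.
  move=> j k; rewrite !inE ![_ == i]eq_sym /h => ij ik.
  have [_ _ _ nj] := pP ij; have [_ _ _ nk] := pP ik.
  have D := p_disj ij ik.
  case: (p i j) nj D => [|x s] nj D; case: (p i k) nk D => [|y t] nk D /= E.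
  - exact: b_inj.
  - by have := nk j; rewrite E mem_head.
  - by have := nj k; rewrite -E mem_head.
  - have := D x; rewrite E !mem_head => /(_ isT isT)/set2_eq[[]//|[ik' ji]].
    by rewrite ji eqxx in ij.
have <- : #|[set~ i]| = 3 by rewrite cardsC1 card_ord.
rewrite -(card_in_imset h_inj); apply: subset_leq_card; apply/subsetP => y.
by case/imsetP => j; rewrite !inE => ji ->; rewrite hP.
Qed.

(** An inner vertex lies on a single subdivided edge, so each of its neighbours follows or
    precedes it on that walk. *)
Lemma inner_nbr i j u v : i != j -> u \in p i j -> u -- v ->
  infix [:: u; v] (w i j) \/ infix [:: v; u] (w i j).
Proof.
move=> ij uij /edges[i' [j' [ij' inf]]].
have [_ _ pji nb] := pP ij; have [_ _ pji' nb'] := pP ij'.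
have uij' : u \in p i' j'.
  have : u \in w i' j' by apply: (mem_infix inf); rewrite mem_head.
  rewrite /w !inE mem_rcons inE => /or3P[/eqP E|/eqP E|//].
    by have := nb i'; rewrite -E uij.
  by have := nb j'; rewrite -E uij.
have [[-> ->]|[-> ->]] := set2_eq (p_disj ij ij' uij uij'); first by left.
right; rewrite -infix_rev.
by have -> : rev (w j' i') = w i' j' by rewrite /w pji' rev_cons rev_rcons revK.
Qed.

Lemma inner_degree i j u : i != j -> u \in p i j -> degree u <= 2.
Proof.
move=> ij uij; have [_ Uw _ _] := pP ij.
pose k := index u (w i j).
apply: (@leq_trans #|[set nth u (w i j) k.+1; nth u (w i j) k.-1]|); last first.
  by rewrite cards2; case: (_ != _).
apply: subset_leq_card; apply/subsetP => v; rewrite !inE => /(inner_nbr ij uij).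
rewrite /k; case=> /(infix2_nth u Uw)[].
  by move=> <- _; rewrite eqxx.
by move=> _ <-; rewrite eqxx orbT.
Qed.

(** An edge between branch vertices lies on some walk, whose inner vertices are not branch
    vertices; so it is the whole walk. *)
Lemma branch_adj i j : b i -- b j -> i != j /\ p i j = [::].
Proof.
move=> bij; have ij : i != j by apply: contraTneq bij => ->; rewrite adj_irrefl.
split=> //; have [i' [j' [ij' inf]]] := edges bij.
have [_ Uw pji nb] := pP ij'.
have E : p i' j' = [::] /\ i' = i /\ j' = j.
  case/infixP: inf => s1 [s2]; rewrite /w; case: s1 => [|x s1] /=.
    case: (p i' j') nb => [|x s] nb /= [/b_inj ->]; first by case=> /b_inj ->.
    by move=> E _; have := nb j; rewrite E mem_head.
  case=> _; rewrite (lastI (b j) s2) -rcons_cons -rcons_cat => /rcons_inj[E _].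
  by have := nb i; rewrite E mem_cat mem_head orbT.
by case: E => [E [<- <-]].
Qed.

Lemma branch_adjE i j : i != j -> p i j = [::] -> b i -- b j.
Proof. by move=> /pP[]; rewrite /w => + _ _ _ => /[swap] ->; rewrite /= andbT. Qed.

(** A vertex of degree two adjacent to both ends of an edge between branch vertices would be
    a second connection between them. *)
Lemma no_bypass i j u : b i -- b j -> u -- b i -> u -- b j -> (forall k, u <> b k) -> False.
Proof.
move=> bij ui uj un; have [ij pij] := branch_adj bij.
have [[k]/un//|[i' [j' [ij' uij]]]] := cover u.
have inw k : u -- b k -> b k \in w i' j'.
  by move=> /(inner_nbr ij' uij)[] /mem_infix; apply; rewrite !inE eqxx ?orbT.
have ij'k k : u -- b k -> k \in [set i'; j'].
  move/inw; rewrite /w !inE mem_rcons inE !(inj_eq b_inj) => /or3P[->|->|]; rewrite ?orbT //.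
  by have [_ _ _ /(_ k)/negbTE->] := pP ij'.
have [_ _ pji _] := pP ij.
have : u \in p i j.
  move: (ij'k _ ui) (ij'k _ uj) uij ij; rewrite !inE.
  case/orP=> /eqP-> /orP[]/eqP-> //; rewrite ?eqxx //.
  by move: ij' => /pP[_ _ -> _]; rewrite mem_rev.
by rewrite pij.
Qed.

End Subdivision.

(** * Constructing subdivisions of K4 inside a graph *)

Lemma infix2_map (T T' : eqType) (f : T -> T') u v s : injective f ->
  infix [:: f u; f v] (map f s) = infix [:: u; v] s.
Proof.
move=> f_inj; elim: s => //= x s IHs; rewrite IHs (inj_eq f_inj).
by case: s {IHs} => //= y s; rewrite (inj_eq f_inj) !prefix0s.
Qed.

Lemma sorted_infix2 (T : eqType) (r : rel T) s :
  (forall u v, infix [:: u; v] s -> r u v) -> sorted r s.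
Proof.
case: s => //= x s; elim: s x => //= y s IHs x rP.
apply/andP; split; first by apply: rP; rewrite /= !eqxx prefix0s.
apply: (IHs y) => u v uv; apply: rP.
by move: uv => /= ->; rewrite !orbT.
Qed.

Lemma flatten_nth_inj (T : eqType) (ss : seq (seq T)) u m n :
  uniq (flatten ss) -> u \in nth [::] ss m -> u \in nth [::] ss n -> m = n.
Proof.
have memF k tt : u \in nth [::] tt k -> u \in flatten tt.
  case: (ltnP k (size tt)) => [lt uk|le]; last by rewrite nth_default.
  by apply/flattenP; exists (nth [::] tt k); rewrite ?mem_nth.
elim: ss m n => [|s ss IHss] m n; first by rewrite nth_nil.
rewrite [flatten _]/= cat_uniq => /and3P[_ /hasPn nos Uss].
case: m n => [|m] [|n] //= um un; last by rewrite (IHss m n).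
- by have := nos u (memF _ _ un); rewrite um.
- by have := nos u (memF _ _ um); rewrite un.
Qed.

Section Skeleton.
Variables (H : sgraph) (b : 'I_4 -> H) (p : 'I_4 -> 'I_4 -> seq H).
Let w i j := b i :: rcons (p i j) (b j).
Hypothesis b_inj : injective b.
Hypothesis pP : forall i j, i != j ->
  [/\ sorted (@adj H) (w i j), uniq (w i j), p j i = rev (p i j) & forall k, b k \notin p i j].
Hypothesis p_disj : forall i j i' j' u, i != j -> i' != j' ->
  u \in p i j -> u \in p i' j' -> [set i; j] = [set i'; j'].
Hypothesis cover : forall u, (exists i, u = b i) \/ (exists i j, i != j /\ u \in p i j).
Hypothesis edges : forall u v, u -- v -> exists i j, i != j /\ infix [:: u; v] (w i j).

Lemma degree3_branch u : 3 <= degree u -> exists i, u = b i.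
Proof.
case: (cover u) => [//|[i [j [ij uij]]]].
by rewrite leqNgt ltnS (inner_degree pP p_disj edges ij uij).
Qed.

Lemma skel_edgeE i j : skel_edge (b i) (b j) = (i != j) && nilp (p i j).
Proof.
rewrite /skel_edge /= !(branch_degree b_inj pP p_disj) !andbT.
apply/idP/andP=> [/(branch_adj b_inj pP edges)[-> ->]//|[ij /nilP pij]].
exact: (branch_adjE pP).
Qed.

Variable k : nat.
Hypothesis k34 : 3 <= k <= 4.
Hypothesis skelP : forall i j : 'I_4, i != j ->
  nilp (p i j) = [&& (i.+1 == j) || (j.+1 == i), i < k & j < k].

(** With the branch vertices numbered along a path, vertex [i] of that path is the branch
    vertex [i]; the branch vertices from [k] on have no edge in the skeleton. *)
Lemma skeleton_iso : isomorphic (skeleton H) (pathg k).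
Proof.
have [k3 k4] := andP k34.
pose wd (i : 'I_k) := widen_ord k4 i.
have adjE (i j : 'I_k) : skel_edge (b (wd i)) (b (wd j)) = (i.+1 == j) || (j.+1 == i).
  rewrite skel_edgeE; case: eqP => [E|/eqP ij].
    have -> : i = j by apply: val_inj; have /= := congr1 val E.
    by rewrite gtn_eqF.
  by rewrite skelP //= !ltn_ord !andbT.
have gP i : [exists y, skel_edge (b (wd i)) y].
  have lt_j : (if i == 0 :> nat then 1 else i.-1) < k.
    by case: ifP => _; [lia | have := ltn_ord i; lia].
  apply/existsP; exists (b (wd (Ordinal lt_j))); rewrite adjE /=.
  by case: (val i) => //= n; rewrite eqxx orbT.
pose g (i : pathg k) : skeleton H := exist (fun x => [exists y,
  skel_edge x y]) (b (wd i)) (gP i).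
have g_inj : injective g.
  move=> i j /(congr1 val) /b_inj /(congr1 val) /= E; exact: val_inj.
have g_surj x : exists i, x == g i.
  suff [i xi] : exists i, val x == b (wd i) by exists i; rewrite -val_eqE.
  case: x => x xP /=; have [y xy] := existsP xP.
  have /and3P[_ /degree3_branch[i xi] /degree3_branch[j yj]] := xy.
  move: (xy); rewrite xi yj skel_edgeE => /andP[ij]; rewrite skelP // => /and3P[_ ik _].
  exists (Ordinal ik); apply/eqP; congr b; exact: val_inj.
pose f x := xchoose (g_surj x).
have fK : cancel f g by move=> x; rewrite -(eqP (xchooseP (g_surj x))).
have gK : cancel g f by move=> i; apply: g_inj; rewrite fK.
exists f; first by exists g.
move=> x y; rewrite -{2}(fK x) -{2}(fK y) [RHS]/= /skel_adj [RHS]/=.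
by have := adjE (f x) (f y); rewrite /skel_edge /= => ->.
Qed.

End Skeleton.

Section Build.
Variables (G : sgraph) (b : 'I_4 -> G) (p : 'I_4 -> 'I_4 -> seq G).
Let w i j := b i :: rcons (p i j) (b j).
Hypothesis b_inj : injective b.
Hypothesis pP : forall i j, i != j ->
  [/\ sorted (@adj G) (w i j), uniq (w i j), p j i = rev (p i j) & forall k, b k \notin p i j].
Hypothesis p_disj : forall i j i' j' u, i != j -> i' != j' ->
  u \in p i j -> u \in p i' j' -> [set i; j] = [set i'; j'].

Let V z := [exists i, z == b i] || [exists i, exists j, (i != j) && (z \in p i j)].
Let HT : finType := {z : G | V z}.
Let hadj (u v : HT) := [exists i, exists j, (i != j) && infix [:: val u; val v] (w i j)].

Let w_rev i j : i != j -> w j i = rev (w i j).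
Proof. by move=> /pP[_ _ E _]; rewrite /w E rev_cons rev_rcons. Qed.

Fact hadj_sym : symmetric hadj.
Proof.
suff sub u v : hadj u v -> hadj v u by move=> u v; apply/idP/idP; apply: sub.
case/existsP=> i /existsP[j /andP[ij uv]]; apply/existsP; exists j; apply/existsP; exists i.
by rewrite eq_sym ij w_rev // -infix_rev revK.
Qed.

Fact hadj_irrefl : irreflexive hadj.
Proof.
move=> u; apply/negbTE/negP; case/existsP=> i /existsP[j /andP[ij inf]].
have [_ Uw _ _] := pP ij.
by have := infix_uniq inf Uw; rewrite cons_uniq mem_head.
Qed.

Let H := SGraph hadj_sym hadj_irrefl.

Let bV i : V (b i). Proof. by apply/orP; left; apply/existsP; exists i. Qed.
Let bH i : H := exist _ (b i) (bV i).
Let pH i j : seq H := pmap insub (p i j).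

Let pHE i j : i != j -> map val (pH i j) = p i j.
Proof.
move=> ij; rewrite /pH (pmap_filter (insubK _)); apply/all_filterP/allP => z zp.
rewrite isSome_insub; apply/orP; right; apply/existsP; exists i; apply/existsP; exists j.
by rewrite ij.
Qed.

Let wHE i j : i != j -> map val (bH i :: rcons (pH i j) (bH j)) = w i j.
Proof. by move=> ij; rewrite /= map_rcons pHE. Qed.

(** The subgraph is carried by the vertices that occur on the given walks, with the pairs of
    consecutive vertices as its edges. *)
Lemma build_K4sub k : 3 <= k <= 4 ->
    (forall i j : 'I_4, i != j ->
      nilp (p i j) = [&& (i.+1 == j) || (j.+1 == i), i < k & j < k]) ->
  exists2 H, K4sub (pathg k) H & subgraph H G.
Proof.
move=> k34 skelP; exists H; last first.
  exists val; first exact: val_inj.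
  move=> x y /existsP[i /existsP[j /andP[ij inf]]]; have [sw _ _ _] := pP ij.
  by have /= := infix_sorted inf sw; rewrite andbT.
have bH_inj : injective bH by move=> i j /(congr1 val) /b_inj.
have pHP i j : i != j -> [/\ sorted (@adj H) (bH i :: rcons (pH i j) (bH j)),
   uniq (bH i :: rcons (pH i j) (bH j)), pH j i = rev (pH i j) & forall k, bH k \notin pH i j].
  move=> ij; have [sw Uw prev nb] := pP ij; split.
  - apply: sorted_infix2 => u v; rewrite -(infix2_map _ _ _ val_inj) wHE // => inf.
    by apply/existsP; exists i; apply/existsP; exists j; rewrite ij.
  - by rewrite -(map_inj_uniq val_inj) wHE.
  - by apply: (inj_map val_inj); rewrite map_rev !pHE // eq_sym.
  - by move=> l; rewrite -(mem_map val_inj) pHE //; exact: nb l.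
have pH_disj i j i' j' u : i != j -> i' != j' ->
    u \in pH i j -> u \in pH i' j' -> [set i; j] = [set i'; j'].
  move=> ij ij'; rewrite -!(mem_map val_inj) !pHE //; exact: p_disj.
have H_cover u : (exists i, u = bH i) \/ (exists i j, i != j /\ u \in pH i j).
  have /orP[/existsP[i /eqP ui]|/existsP[i /existsP[j /andP[ij uij]]]] := valP u.
    by left; exists i; apply: val_inj.
  by right; exists i, j; rewrite -(mem_map val_inj) pHE.
have H_edges (u v : H) : u -- v -> exists i j, i != j /\ infix [:: u;
  v] (bH i :: rcons (pH i j) (bH j)).
  case/existsP=> i /existsP[j /andP[ij uv]]; exists i, j; split=> //.
  by rewrite -(infix2_map _ _ _ val_inj) wHE.
split; first by exists bH, pH; split.
apply: (skeleton_iso (b := bH) (p := pH)) => // i j ij.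
by rewrite -skelP // -(pHE ij) /nilp size_map.
Qed.

End Build.

(** Position of the unordered pair [m], [n] in the list 01, 02, 03, 12, 13, 23. *)
Definition pair_index (m n : nat) : nat :=
  match m, n with
  | 0, 1 | 1, 0 => 0
  | 0, 2 | 2, 0 => 1
  | 0, 3 | 3, 0 => 2
  | 1, 2 | 2, 1 => 3
  | 1, 3 | 3, 1 => 4
  | _, _ => 5
  end.

Lemma pair_indexC m n : pair_index m n = pair_index n m.
Proof. by move: m n => [|[|[|[|m]]]] [|[|[|[|n]]]]. Qed.

Lemma pair_index_inj (i j i' j' : 'I_4) : i != j -> i' != j' ->
  pair_index i j = pair_index i' j' ->
  [set i; j] = [set i'; j'].
Proof.
have lt_case (a b a' b' : 'I_4) : a < b -> a' < b' -> pair_index a b = pair_index a' b' ->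
  [set a; b] = [set a'; b'].
  move=> ab ab' E; suff [-> ->] : a = a' /\ b = b' by [].
  case: a b a' b' ab ab' E => [[|[|[|[|//]]]] ?] [[|[|[|[|//]]]] ?] [[|[|[|[|//]]]] ?]
    [[|[|[|[|//]]]] ?] //= _ _ _;
  by split; apply: val_inj.
wlog ij : i j / i < j => [hw ij ij' E|_].
  case: (ltngtP i j) => [lt_ij|lt_ji|/val_inj ij_eq].
  - exact: hw.
  - by rewrite setUC; apply: hw; rewrite // 1?eq_sym // pair_indexC.
  - by rewrite ij_eq eqxx in ij.
case: (ltngtP i' j') => [ij' _|ij' _|/val_inj->]; last by rewrite eqxx.
  exact: lt_case.
by move=> E; rewrite (setUC [set i']); apply: lt_case => //; rewrite E pair_indexC.
Qed.

Section FourPaths.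
Variables (G : sgraph) (a b c d : G) (p01 p02 p03 p12 p13 p23 : seq G).
Hypotheses (L01 : link a p01 b) (L02 : link a p02 c) (L03 : link a p03 d)
  (L12 : link b p12 c) (L13 : link b p13 d) (L23 : link c p23 d).
Hypothesis U : uniq ([:: a; b; c; d] ++ flatten [:: p01; p02; p03; p12; p13; p23]).

Let br (i : 'I_4) := nth a [:: a; b; c; d] i.
Let ps m := nth [::] [:: p01; p02; p03; p12; p13; p23] m.
Let pp (i j : 'I_4) := if i < j then ps (pair_index i j) else rev (ps (pair_index i j)).

Lemma four_paths_K4sub k : 3 <= k <= 4 ->
    (forall i j : 'I_4, i < j ->
      nilp (ps (pair_index i j)) = (i.+1 == j) && (j < k)) ->
  exists2 H, K4sub (pathg k) H & subgraph H G.
Proof.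
move=> k34 skelP.
have Ub : uniq [:: a; b; c; d] by move: U; rewrite cat_uniq => /andP[].
have Uf : uniq (flatten [:: p01; p02; p03; p12; p13; p23]).
  by move: U; rewrite cat_uniq => /and3P[].
have br_inj : injective br.
  by move=> i j /eqP; rewrite /br nth_uniq // => /eqP/val_inj.
have ppC i j : i != j -> pp j i = rev (pp i j).
  rewrite /pp pair_indexC -val_eqE; case: ltngtP => //= _ _; by rewrite ?revK.
have pp_ps i j u : u \in pp i j -> u \in ps (pair_index i j).
  by rewrite /pp; case: ifP; rewrite ?mem_rev.
have lt_ok (i j : 'I_4) : i < j -> link (br i) (ps (pair_index i j)) (br j) /\ uniq [:: br i,
  br j & ps (pair_index i j)].
  case: i j => [[|[|[|[|//]]]] ?] [[|[|[|[|//]]]] ?] //= _; split=> //; rewrite /br /ps /=;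
    ucount U.
apply: (@build_K4sub _ br pp) => // [i j ij|i j i' j' u ij ij' /pp_ps ui /pp_ps ui'|i j ij].
- have [Lp Up] : link (br i) (pp i j) (br j) /\ uniq [:: br i, br j & pp i j].
    move: ij; rewrite /pp -val_eqE; case: ltngtP => //= ij _; have [L UU] := lt_ok _ _ ij => //.
    by rewrite pair_indexC link_rev; split=> //; ucount UU.
  split; [exact: Lp | by ucount Up | exact: ppC | ].
  move=> k0; apply/negP => /pp_ps; have brm : br k0 \in [:: a; b; c; d] by rewrite mem_nth.
  move: U; rewrite cat_uniq => /and3P[_ /hasPn h _] brp.
  have /h : br k0 \in flatten [:: p01; p02; p03; p12; p13; p23].
    apply/flattenP; exists (ps (pair_index i j)) => //; apply: mem_nth.
    by move: (val i) (val j) => [|[|[|[|m]]]] [|[|[|[|n]]]].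
  by rewrite /= brm.
- apply: pair_index_inj => //; exact: flatten_nth_inj ui'.
- move: ij; rewrite -val_eqE /pp; case: ltngtP => //= ij _.
    rewrite skelP //; move: (ltn_ord j) ij; clear; lia.
  rewrite pair_indexC /nilp size_rev -/(nilp _) skelP //; move: (ltn_ord i) ij; clear; lia.
Qed.

End FourPaths.

(** The two forbidden graphs at once. When [p3] and [p4] are both nonempty the unsubdivided
    edges form the path [a b c]; when one of them is empty, the path on four vertices. *)
Lemma asp_forbids (G : sgraph) (a b c d : G) (p1 p2 p3 p4 : seq G) : ASP G ->
    b -- a -> b -- c -> link a p1 c -> link b p2 d -> link a p3 d -> link c p4 d ->
    uniq ([:: a; b; c; d] ++ p1 ++ p2 ++ p3 ++ p4) ->
    ~~ nilp p1 -> ~~ nilp p2 -> ~~ nilp (p3 ++ p4) -> False.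
Proof.
move=> asp ba bc L1 L2 L3 L4 U n1 n2 n34.
wlog n3 : a c p1 p3 p4 ba bc L1 L3 L4 U n1 n34 / ~~ nilp p3 => [hw|].
  case: (boolP (nilp p3)) => [/nilP e3|]; last exact: (hw a c p1 p3 p4).
  apply: (hw c a (rev p1) p4 p3) => //; rewrite ?link_rev //.
  - by ucount U.
  - by rewrite /nilp size_rev.
  - by move: n34; rewrite e3 cats0.
  - by move: n34; rewrite e3.
have ab : a -- b by rewrite adj_sym.
have k34 : 3 <= (if nilp p4 then 4 else 3) <= 4 by case: ifP.
have [|||||||i j ij|H KH sHG] := @four_paths_K4sub G a b c d [::] p1 p3 [::] p2 p4 _ _ _ _ _ _
  _ _ k34.
all: rewrite ?link_nil //.
- by ucount U.
- case: i j ij => [[|[|[|[|//]]]] ?] [[|[|[|[|//]]]] ?] //= _;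
  rewrite ?(negbTE n1) ?(negbTE n2) ?(negbTE n3) //.
  all: try by case: (nilp p4).
by apply: (asp H _ sHG); case: ifP KH => _ KH; [right | left].
Qed.

(** * Three vertices with three sides *)

Lemma uniq_cat_disj (T : eqType) (P : pred T) (s t : seq T) :
  uniq s -> uniq t -> {in s, forall z, P z} -> {in t, forall z, ~~ P z} -> uniq (s ++ t).
Proof.
move=> Us Ut sP tP; rewrite cat_uniq Us Ut andbT; apply/hasPn => z /tP; apply: contra;
  exact: sP.
Qed.

Definition K3r_type (G : sgraph) : Prop :=
  exists r : nat, [/\ 4 <= r, subgraph (K3 r) G & subgraph G (D r)].

(** The neighbours of a vertex of smaller degree would be a cut. *)
Lemma min_degree G (G3 : k_connected 3 G) (v : G) : 3 <= degree v.
Proof.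
rewrite leqNgt; apply/negP => dv; have [nG conn] := G3.
pose A := [set y | v -- y].
have vA : v \notin A by rewrite inE adj_irrefl.
have [u uP] : exists u, u \notin v |: A.
  apply/existsP; rewrite -negb_forall; apply/negP => /forallP all_in.
  have : #|G| <= #|v |: A| by rewrite -cardsT; apply: subset_leq_card; apply/subsetP => u _;
    exact: all_in.
  by rewrite cardsU1 vA; move: nG dv; rewrite /degree -/A; lia.
move: uP; rewrite in_setU1 negb_or => /andP[uv uA].
have /connectP[s Ps E] := conn A dv v u vA uA.
case: s Ps E => [_ /= E|w s /= /andP[/and3P[_ wA vw] _]]; first by rewrite E eqxx in uv.
by rewrite inE vw in wA.
Qed.

Lemma mem_last_rcons (T : eqType) (s : seq T) x : x \in rcons s x.
Proof. by rewrite mem_rcons mem_head. Qed.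

Lemma mem_rcons_r (T : eqType) (s : seq T) x y : y \in s -> y \in rcons s x.
Proof. by rewrite mem_rcons inE => ->; rewrite orbT. Qed.

Section Sides.
Variable G : sgraph.
Hypotheses (G3 : k_connected 3 G) (asp : ASP G).

(** A nonempty union of components of [G - X]; unlike components, sides are closed under
    taking the part of [G - X] left over by two of them. *)
Definition side (X K : {set G}) : Prop :=
  [/\ K != set0, [disjoint K & X] &
      forall u v, u \in K -> u -- v -> (v \in K) || (v \in X)].

Lemma side_link X K u s t : side X K -> link u s t -> u \in K ->
  {in s, forall z, z \notin X} -> {subset s <= K}.
Proof.
move=> [_ _ cl]; elim: s u => // w s IHs u; rewrite link_cons => /andP[uw Ls] uK sX z.
have wK : w \in K.
  by have := cl _ _ uK uw; rewrite (negbTE (sX w (mem_head _ _))) orbF.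
rewrite inE => /predU1P[->//|]; apply: (IHs w) => // y ys.
by apply: sX; rewrite inE ys orbT.
Qed.

Lemma side_exit (X K A : {set G}) u x : side X K -> u \in K -> #|A| < 3 -> u \notin A ->
    x \in X -> x \notin A ->
  exists s y, [/\ y \in X, y \notin A, link u s y, uniq (u :: s) & {in s, forall z,
    (z \in K) && (z \notin A)}].
Proof.
move=> sK uK A3 uA xX xA; have [_ dKX _] := sK.
have dST z : pred1 u z -> z \notin X by move=> /eqP->; rewrite (disjointFr dKX).
have [p [s [y [/eqP-> yX Ls Us [_ yA sP]]]]] :=
  bridge3 (S := pred1 u) (T := mem X) G3 A3 (eqxx u) xX uA xA dST.
exists s, y; split=> //; first by ucount Us.
have sX : {in s, forall z, z \notin X} by move=> z /sP /and3P[].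
move=> z zs; rewrite (side_link sK Ls) //=.
by have /and3P[] := sP _ zs.
Qed.

Section Three.
Variables (X : {set G}) (x y z : G).
Hypotheses (Uxyz : uniq [:: x; y; z]) (XE : X =i [:: x; y; z]).

Let xX : x \in X. Proof. by rewrite XE mem_head. Qed.
Let yX : y \in X. Proof. by rewrite XE !inE eqxx orbT. Qed.
Let zX : z \in X. Proof. by rewrite XE !inE eqxx !orbT. Qed.

Let nK K u : side X K -> u \in K -> [/\ u != x, u != y & u != z].
Proof.
move=> [_ dKX _] uK; have : u \notin X by rewrite (disjointFr dKX).
by rewrite XE !inE !negb_or => /and3P[].
Qed.

Let xyz : [/\ x != y, x != z & y != z].
Proof. by move: Uxyz; rewrite /uniq !inE negb_or => /and3P[/andP[-> ->] -> _]. Qed.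

Lemma side_fan K a : side X K -> a \in K ->
  exists s t, [/\ link a s y, link a t z, {subset s <= K},
    {subset t <= K} & uniq (a :: s ++ t)].
Proof.
move=> sK aK; have [ax ay az] := nK sK aK; have [xy xz yz] := xyz.
have [|||||s [y' [t [z' [/eqP-> /eqP-> Ls Lt [sK' tK' U]]]]]] := @fan G K a (pred1 y) (pred1 z).
- exact: aK.
- by move=> w /(nK sK)[_ wy wz]; rewrite /= negb_or wy wz.
- have [||||s [w [wX wA Ls _ sP]]] := @side_exit X K [set x; z] a y sK aK;
  rewrite // ?cards2 ?inE ?negb_or ?ax ?az 1?(eq_sym y) ?xy //.
    by case: (_ != _).
  exists s, w; split=> //; last by move=> v /sP/andP[].
  by move: wX wA; rewrite XE !inE negb_or => /or3P[]/eqP-> //; rewrite eqxx ?andbF.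
- have [||||s [w [wX wA Ls _ sP]]] := @side_exit X K [set x; y] a z sK aK;
  rewrite // ?cards2 ?inE ?negb_or ?ax ?ay ?(eq_sym z) ?xz //.
    by case: (_ != _).
  exists s, w; split=> //; last by move=> v /sP/andP[].
  by move: wX wA; rewrite XE !inE negb_or => /or3P[]/eqP-> //; rewrite eqxx ?andbF.
- move=> w wK wa; have [_ wy _] := nK sK wK.
  have [||||s [v [vX vA Ls _ sP]]] := @side_exit X K [set x; w] a y sK aK;
    rewrite // ?cards2 ?inE ?negb_or ?ax ?(eq_sym a) ?(eq_sym y) ?xy //.
    by case: (_ != _).
  exists s, v; split=> //.
  + by move: vX vA; rewrite XE !inE negb_or => /or3P[]/eqP-> //; rewrite eqxx ?orbT.
  + by move=> u /sP/andP[].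
  + by apply/negP => /sP; rewrite !inE eqxx orbT andbF.
- by exists s, t.
Qed.

Lemma side_contact K : side X K -> exists2 a, a \in K & a -- x.
Proof.
move=> sK; have [/set0Pn[u uK] _ _] := sK.
have [ux uy uz] := nK sK uK; have [xy xz yz] := xyz.
have [||||s [w [wX wA Ls _ sP]]] := @side_exit X K [set y; z] u x sK uK;
  rewrite // ?cards2 ?inE ?negb_or ?uy ?uz ?xy //.
  by case: (_ != _).
have wx : w = x by move: wX wA; rewrite XE !inE negb_or => /or3P[]/eqP-> //;
  rewrite eqxx ?andbF.
move: Ls; rewrite wx /link rcons_path => /andP[_ lx]; exists (last u s) => //.
by have := mem_last u s; rewrite inE => /predU1P[->//|/sP/andP[]].
Qed.

Lemma side_thru K : side X K -> exists s, [/\ link x s z, {subset s <= K}, ~~ nilp s & uniq s].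
Proof.
move=> sK; have [u uK ux] := side_contact sK.
have [_ uy uz] := nK sK uK; have [xy xz yz] := xyz.
have [s [t [_ Lt _ tK U]]] := side_fan sK uK.
exists (u :: t); split=> //; first by rewrite link_cons adj_sym ux.
  by move=> v; rewrite inE => /predU1P[->//|/tK].
by ucount U.
Qed.

(** The fourth branch vertex is [z]: the edges [x a] and [x c] lead into two sides, which
    are joined to each other through [y] and to [z] by fans, and the third side links [x] to
    [z]. *)
Lemma three_sides_fan K1 K2 K3 a s t : side X K1 -> side X K2 -> side X K3 ->
    [disjoint K1 & K2] -> [disjoint K1 & K3] -> [disjoint K2 & K3] ->
    a \in K1 -> a -- x -> link a s y -> link a t z -> {subset s <= K1} -> {subset t <= K1} ->
    uniq (a :: s ++ t) -> ~~ nilp t -> False.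
Proof.
move=> sd1 sd2 sd3 d12 d13 d23 aK ax Ls Lt sK tK U1 tn.
have [c cK cx] := side_contact sd2.
have [s' [t' [Ls' Lt' sK' tK' U2]]] := side_fan sd2 cK.
have [r [Lr rK rn U3]] := side_thru sd3.
have inK (K : {set G}) (v : G) (l l' : seq G) : v \in K -> {subset l <= K} ->
  {subset l' <= K} -> {subset v :: l ++ l' <= K}.
  by move=> vK lK lK' w; rewrite inE mem_cat => /or3P[/eqP->|/lK|/lK'].
have nX K w : side X K -> w \in [:: x; y; z] -> w \notin K.
  by move=> [_ dK _]; rewrite -XE => wX; rewrite (disjointFl dK).
have U23 : uniq ((c :: s' ++ t') ++ r ++ [:: x; y; z]).
  apply: (uniq_cat_disj (P := mem K2)) => //.
  - apply: (uniq_cat_disj (P := mem K3)) => // w; exact: nX sd3.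
  - exact: inK.
  - move=> w /=; rewrite mem_cat => /orP[/rK wr|];
    [by rewrite (disjointFl d23) | exact: nX sd2].
have U : uniq ((a :: s ++ t) ++ (c :: s' ++ t') ++ r ++ [:: x; y; z]).
  apply: (uniq_cat_disj (P := mem K1)) => //; first exact: inK.
  move=> w; rewrite mem_cat => /orP[/(inK _ _ _ _ cK sK' tK') wr|] /=;
    first by rewrite (disjointFl d12).
  rewrite mem_cat => /orP[/rK wr|]; [by rewrite (disjointFl d13) | exact: nX sd1].
apply: (@asp_forbids G a x c z (s ++ y :: rev s') r t t' asp) => //.
- by rewrite adj_sym.
- by rewrite adj_sym.
- by rewrite link_cat Ls link_rev.
- by ucount U.
- by case: (s).
- by move: tn; case: (t).
Qed.

End Three.

(** A second vertex [v] in the side gives a fan from [a] with a leg of length at least two: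
    if the first fan consists of edges, leave through [v] instead. *)
Lemma three_sides_star (X : {set G}) (x y z : G) (K1 K2 K3 : {set G}) (a v : G) : uniq [:: x;
  y; z] -> X =i [:: x; y; z] ->
    side X K1 -> side X K2 -> side X K3 ->
    [disjoint K1 & K2] -> [disjoint K1 & K3] -> [disjoint K2 & K3] ->
    a \in K1 -> v \in K1 -> a -- x -> a -- v -> False.
Proof.
move=> U XE sd1 sd2 sd3 d12 d13 d23 aK vK ax av.
have U' : uniq [:: x; z; y] by ucount U.
have XE' : X =i [:: x; z; y] by move=> w; rewrite XE !inE; do 3!case: eqP.
have [s [t [Ls Lt sK tK Ust]]] := side_fan U XE sd1 aK.
have tn : nilp t.
  by apply/negP => /negP tn; exact: (three_sides_fan U XE sd1 sd2 sd3 d12 d13 d23 aK ax Ls Lt).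
have sn : nilp s.
  apply/negP => /negP sn; apply: (three_sides_fan U' XE' sd1 sd2 sd3 d12 d13 d23 aK ax Lt Ls)
    => //.
  by ucount Ust.
move: Ls Lt; rewrite (nilP sn) (nilP tn) => Ls Lt.
have vX : v \notin X by case: sd1 => _ dK _; rewrite (disjointFr dK).
have aX : a \notin X by case: sd1 => _ dK _; rewrite (disjointFr dK).
have va : v != a by apply: contraTneq av => ->; rewrite adj_irrefl.
have vx : v != x by move: vX; rewrite XE inE negb_or => /andP[].
have yX : y \in X by rewrite XE !inE eqxx orbT.
have yA : y \notin [set x; a].
  rewrite !inE negb_or; apply/andP; split; last by apply: contraNneq aX => <-.
  by move: U; rewrite cons_uniq inE negb_or eq_sym => /andP[/andP[]].
have [||r [w [wX wA Lr Ur rP]]] := side_exit (A := [set x; a]) sd1 vK _ _ yX yA.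
- by rewrite cards2; case: (_ != _).
- by rewrite !inE negb_or vx va.
have Lr' : link a (v :: r) w by rewrite link_cons av.
have rK : {subset v :: r <= K1} by move=> b; rewrite inE => /predU1P[->//|/rP/andP[]].
have Uar : uniq (a :: [::] ++ v :: r).
  rewrite cat0s cons_uniq Ur andbT inE negb_or eq_sym va.
  by apply/negP => /rP; rewrite !inE eqxx orbT andbF.
have sub0 : {subset [::] <= K1} by [].
move: wX wA; rewrite XE !inE negb_or => /or3P[]/eqP E /andP[wx wa];
  first by rewrite E eqxx in wx.
  subst w; exact: (three_sides_fan U' XE' sd1 sd2 sd3 d12 d13 d23 aK ax Lt Lr').
subst w; exact: (three_sides_fan U XE sd1 sd2 sd3 d12 d13 d23 aK ax Ls Lr').
Qed.

Lemma three_sides_edgeless (X : {set G}) (x y z : G) (K1 K2 K3 : {set G}) (u v : G) : uniq [::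
  x; y; z] -> X =i [:: x; y; z] ->
    side X K1 -> side X K2 -> side X K3 ->
    [disjoint K1 & K2] -> [disjoint K1 & K3] -> [disjoint K2 & K3] ->
    u \in K1 -> v \in K1 -> u -- v -> False.
Proof.
move=> U XE sd1 sd2 sd3 d12 d13 d23 uK vK uv.
have xX : x \in X by rewrite XE mem_head.
have [|||r [w [wX _ Lr Ur rP]]] := side_exit (A := set0) sd1 uK _ _ xX.
- by rewrite cards0.
- by rewrite inE.
- by rewrite inE.
have [a [v' [aK vK' aw av']]] : exists a v', [/\ a \in K1, v' \in K1, a -- w & a -- v'].
  case/lastP: r Lr {Ur} rP => [|r a]; rewrite ?link_nil => Lr rP; first by exists u, v.
  have aK : a \in K1 by have /andP[] := rP a (mem_last_rcons _ _).
  move: Lr; rewrite /link !rcons_path last_rcons => /andP[/andP[_ la] aw].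
  exists a, (last u r); split=> //; last by rewrite adj_sym.
  have := mem_last u r; rewrite inE => /predU1P[->//|lr].
  by have /andP[] := rP (last u r) (mem_rcons_r a lr).
move: wX; rewrite XE !inE => /or3P[]/eqP E; subst w.
- exact: (three_sides_star U XE sd1 sd2 sd3 d12 d13 d23 aK vK' aw av').
- have U' : uniq [:: y; x; z] by ucount U.
  have XE' : X =i [:: y; x; z] by move=> w; rewrite XE !inE; do 3!case: eqP.
  exact: (three_sides_star U' XE' sd1 sd2 sd3 d12 d13 d23 aK vK' aw av').
- have U' : uniq [:: z; x; y] by ucount U.
  have XE' : X =i [:: z; x; y] by move=> w; rewrite XE !inE; do 3!case: eqP.
  exact: (three_sides_star U' XE' sd1 sd2 sd3 d12 d13 d23 aK vK' aw av').
Qed.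

(** A vertex off [X] has at least three neighbours, all in [X]. *)
Lemma cover3_K3r (X : {set G}) (x y z : G) : 6 < #|G| -> uniq [:: x; y; z] -> X =i [:: x; y;
  z] ->
    (forall u v, u -- v -> (u \in X) || (v \in X)) -> K3r_type G.
Proof.
move=> nG U XE cov.
pose r := #|~: X|.
have X3 : #|X| = 3 by rewrite (eq_card XE); apply/card_uniqP.
have rE : #|G| = 3 + r by rewrite -X3 /r cardsC.
have full w v : w \in X -> v \notin X -> w -- v.
  move=> wX vX; suff : w \in [set y | v -- y] by rewrite inE adj_sym.
  have sub : [set y | v -- y] \subset X.
    by apply/subsetP => t; rewrite inE => /cov; rewrite (negbTE vX).
  by have /eqP-> : [set y | v -- y] == X by rewrite eqEcard sub X3 min_degree.
pose h (t : 'I_3 + 'I_r) : G :=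
  match t with inl i => nth x [:: x; y; z] i | inr j => enum_val j end.
have hX i : h (inl i) \in X by rewrite XE mem_nth.
have hnX j : h (inr j) \notin X by have := enum_valP j; rewrite inE.
have h_inj : injective h.
  move=> [i|j] [i'|j'] E.
  - by congr inl; move: E => /eqP; rewrite /h nth_uniq // => /eqP/val_inj.
  - by have := hnX j'; rewrite -E hX.
  - by have := hnX j; rewrite E hX.
  - by congr inr; apply: enum_val_inj.
exists r; split; first by lia.
  by exists h => // -[i|j] [i'|j'] // _; [|rewrite adj_sym]; apply: full.
have [|g hK gK] := inj_card_bij h_inj; first by rewrite card_sum !card_ord rE.
exists g; first exact: can_inj gK.
move=> u v uv; have := cov _ _ uv; rewrite -{1}(gK u) -{1}(gK v).
have : g u != g v by rewrite (can_eq gK); apply: contraTneq uv => ->; rewrite adj_irrefl.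
case: (g u) (g v) => [i|j] [i'|j'] //=.
by rewrite (negbTE (hnX j)) (negbTE (hnX j')).
Qed.

Definition component (X : {set G}) u := [set w | connect (avoid X) u w].

Lemma avoid_sym (X : {set G}) : connect_sym (avoid X).
Proof. by apply: sym_connect_sym => u v; rewrite /avoid /= adj_sym andbCA. Qed.

Lemma component_side (X : {set G}) u : u \notin X -> side X (component X u).
Proof.
move=> uX; have cX w : connect (avoid X) u w -> w \notin X.
  case/connectP=> s; case/lastP: s => [_ ->//|s t]; rewrite rcons_path last_rcons.
  by move=> /andP[_ /and3P[_ tX _]] ->.
split.
- by apply/set0Pn; exists u; rewrite inE connect0.
- by rewrite disjoint_subset; apply/subsetP => w; rewrite !inE => /cX.
- move=> w v; rewrite !inE => uw wv; rewrite orbC -implyNb; apply/implyP => vX.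
  by apply: connect_trans (uw) (connect1 _); rewrite /avoid /= vX wv (cX _ uw).
Qed.

(** The components of [u] and of [v] and the part containing [w] are three sides, and any
    edge off [X] lies in one of them. *)
Lemma separated_K3r (X : {set G}) (x y z u v w : G) : 6 < #|G| -> uniq [:: x; y; z] ->
  X =i [:: x; y; z] ->
    u \notin X -> v \notin X -> w \notin X ->
    ~~ connect (avoid X) u v -> ~~ connect (avoid X) u w -> ~~ connect (avoid X) v w ->
  K3r_type G.
Proof.
move=> nG U XE uX vX wX uv uw vw.
have dis a b : ~~ connect (avoid X) a b -> [disjoint component X a & component X b].
  move=> ab; rewrite disjoint_subset; apply/subsetP => t; rewrite !inE => at_.
  by apply: contra ab => bt; apply: connect_trans at_ _; rewrite avoid_sym.
have sdu := component_side uX; have sdv := component_side vX.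
pose R := ~: (X :|: component X u :|: component X v).
have sdR : side X R.
  split.
  - by apply/set0Pn; exists w; rewrite !inE !negb_or wX uw vw.
  - by rewrite disjoint_subset; apply/subsetP => t; rewrite !inE !negb_or => /andP[/andP[]].
  - move=> a b; rewrite !inE !negb_or => /andP[/andP[aX ua] va] ab.
    case: (boolP (b \in X)) => [_|bX]; rewrite ?orbT //= orbF.
    apply/andP; split; [apply: contra ua | apply: contra va] => cb;
      by apply: connect_trans cb (connect1 _); rewrite /avoid /= aX bX adj_sym.
have duR : [disjoint component X u & R].
  by rewrite disjoint_subset; apply/subsetP => t tu; move: tu; rewrite !inE => ->;
    rewrite !orbT.
have dvR : [disjoint component X v & R].
  by rewrite disjoint_subset; apply/subsetP => t tv; move: tv; rewrite !inE => ->;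
    rewrite !orbT.
have duv := dis _ _ uv.
apply: (cover3_K3r nG U XE) => a b ab; rewrite -[_ || _]negbK negb_or; apply/negP =>
  /andP[aX bX].
have cl K : side X K -> a \in K -> b \in K.
  by move=> [_ _ cK] aK; have := cK _ _ aK ab; rewrite (negbTE bX) orbF.
have [au|au] := boolP (a \in component X u).
  exact: (three_sides_edgeless U XE sdu sdv sdR duv duR dvR au (cl _ sdu au) ab).
have [av|av] := boolP (a \in component X v).
  rewrite disjoint_sym in duv.
  exact: (three_sides_edgeless U XE sdv sdu sdR duv dvR duR av (cl _ sdv av) ab).
have aR : a \in R by rewrite inE !in_setU !negb_or aX au av.
rewrite disjoint_sym in duR; rewrite disjoint_sym in dvR.
exact: (three_sides_edgeless U XE sdR sdu sdv duR dvR duv aR (cl _ sdR aR) ab).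
Qed.

End Sides.

(** * A circuit through all neighbours of a vertex *)

Section Circuits.
Variable G : sgraph.
Hypotheses (G3 : k_connected 3 G) (asp : ASP G) (G7 : 6 < #|G|).

Lemma cycle_split (c : seq G) p q : cycle (@adj G) c -> uniq c -> p \in c -> q \in c ->
  p != q ->
  exists A B, [/\ link p A q, link q B p,
    uniq (p :: q :: A ++ B) & perm_eq c (p :: A ++ q :: B)].
Proof.
move=> cc Uc pc qc pq; have [i s E] := rot_to pc.
have Us : uniq (p :: s) by rewrite -E rot_uniq.
have Ls : link p s p by move: cc; rewrite -(rot_cycle i) E.
have qs : q \in s by move: qc; rewrite -(mem_rot i) E inE eq_sym (negbTE pq).
case/splitPr: qs Us Ls E => A B Us; rewrite link_cat => /andP[LA LB] E.
exists A, B; split=> //; first by ucount Us.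
by rewrite -E perm_sym perm_rot.
Qed.

(** An edge counts as the circuit of length two, so that the search for a circuit with many
    neighbours of [b] can start from any edge. *)
Definition circuit_off b (c : seq G) := [/\ cycle (@adj G) c, uniq (b :: c) & 1 < size c].

(** The connection can be taken to avoid one of the three vertices; closing it through [p],
    that vertex and [q] gives a circuit through all three. *)
Lemma three_common_nbrs b p q x1 x2 x3 : uniq [:: b; p; q; x1; x2; x3] ->
    {in [:: x1; x2; x3], forall x, [&& x -- b, x -- p & x -- q]} ->
    connect (avoid [set p; q; b]) x1 x2 ->
  exists2 c, circuit_off b c & count (adj b) [:: p; q] + 3 <= count (adj b) c.
Proof.
move=> U N; pose T := [pred z | z \in [:: x2; x3]].
have [N1 N2 N3] : [/\ [&& x1 -- b, x1 -- p & x1 -- q], [&& x2 -- b, x2 -- p & x2 -- q]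
   & [&& x3 -- b, x3 -- p & x3 -- q]] by split; apply: N; rewrite !inE eqxx ?orbT.
have n12 : x1 \notin [:: x2; x3].
  by move: U; rewrite -[X in uniq X]/([:: b; p; q] ++ [:: x1; x2; x3]) cat_uniq cons_uniq =>
    /and3P[_ _ /andP[]].
have x1A : x1 \notin [set p; q; b].
  by rewrite !inE !negb_or; case/and3P: N1 => h1 h2 h3; apply/andP; split; [apply/andP; split|];
    apply: contraTneq isT => E; [move: h2|move: h3|move: h1]; rewrite E adj_irrefl.
move=> cn.
have dST z : pred1 x1 z -> ~~ T z by move=> /eqP->.
have [||y [r [z [/eqP-> Tz Lr Ur [_ _ rP]]]]] := connect_bridge (S := pred1 x1) (T := T) cn _ _
  x1A dST.
- exact: eqxx.
- by rewrite /T /= mem_head.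
have {Ur} Ur : uniq (r ++ [:: b; p; q; x1; x2; x3]).
  apply: (uniq_cat_disj (P := mem r)) => //; first by ucount Ur.
  move=> w wE; apply/negP => /rP /and3P[wx1 wT wA]; move: wE wT wA wx1.
  rewrite /T /= !inE !negb_or.
  by case/or4P => [/eqP->|/eqP->|/eqP->|/or3P[/eqP->|/eqP->|/eqP->]];
     rewrite ?eqxx ?andbF //=; case: eqP.
have [z' [Uz bz' z'p z'q]] : exists z', [/\ uniq (r ++ [:: b; p; q; x1; z; z']), z' -- b,
  z' -- p & z' -- q].
  move: Tz; rewrite /T /= !inE => /orP[]/eqP->; [exists x3 | exists x2]; split=> //.
  all: try by case/and3P: N3. all: try by case/and3P: N2. 
  by ucount Ur.
have [zb zp zq] : [/\ z -- b, z -- p & z -- q].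
  by move: Tz; rewrite /T /= !inE => /orP[]/eqP->; [case/and3P: N2|case/and3P: N3].
have [x1b x1p x1q] := and3P N1.
exists (p :: x1 :: r ++ [:: z; q; z']).
  split; last by rewrite /= size_cat.
    rewrite -[cycle _ _]/(link p (x1 :: r ++ [:: z; q; z']) p) link_cons link_cat Lr.
    by rewrite !link_cons link_nil adj_sym x1p zq adj_sym z'q z'p.
  by ucount Uz.
rewrite /= !count_cat /= !(adj_sym b) x1b zb bz'; clear; lia.
Qed.

Lemma off_bridge (b w : G) (T : pred G) u y : u != b -> u != w -> T y -> y != b -> y != w ->
  ~~ T u ->
  exists s t, [/\ T t, link u s t, t != b, t != w & {in s, forall z, [&& z != b,
    z != w & ~~ T z]}].
Proof.
move=> ub uw Ty yb yw uT.
have dST z : pred1 u z -> ~~ T z by move=> /eqP->.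
have [|||p [s [t [/eqP-> Tt Ls _ [_ tA sP]]]]] :=
  @bridge3 G [set b; w] (pred1 u) T u y G3 _ (eqxx _) Ty _ _ dST.
- by rewrite cards2; case: (_ != _).
- by rewrite !inE negb_or ub uw.
- by rewrite !inE negb_or yb yw.
exists s, t; move: tA; rewrite !inE negb_or => /andP[-> ->]; split=> // z /sP.
by rewrite !inE negb_or => /and3P[_ -> /andP[-> ->]].
Qed.

Lemma circuit_fan b c u : circuit_off b c -> u != b -> u \notin c ->
  exists p q s t, [/\ p \in c, q \in c, p != q, link u s p & link u t q] /\
    uniq ((u :: s ++ t) ++ b :: c).
Proof.
move=> [cc Ubc c2] ub uc.
have bc : b \notin c by move: Ubc; rewrite cons_uniq => /andP[].
have [c0 [c1 [c0c c1c c01]]] : exists c0 c1, [/\ c0 \in c, c1 \in c & c0 != c1].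
  case: (c) c2 Ubc => [|c0 [|c1 c']] // _ U; exists c0, c1; rewrite !inE !eqxx orbT; split=> //.
  by move: U; rewrite !cons_uniq !inE !negb_or => /and4P[_ /andP[]].
have nb v : v \in c -> v != b by apply: contraTneq => ->.
have nu v : v \in c -> v != u by apply: contraTneq => ->.
have [|||s0 [p0 [p0c Ls0 _ _ s0P]]] := @off_bridge b b [pred z | z \in c] u c0 ub ub c0c;
  rewrite ?nb //.
rewrite /= in p0c.
pose I := ~: [set z | z \in b :: c].
have inI z : z != b -> z \notin c -> z \in I by rewrite !inE negb_or => -> ->.
have [|||||s [p [t [q [pT qT Ls Lt [sI tI U]]]]]] :=
  @fan G I u (pred1 p0) [pred z | (z \in c) && (z != p0)].
- exact: inI.
- move=> z; rewrite !inE negb_or => /andP[_ zc]; rewrite (negbTE zc) orbF.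
  by apply: contra zc => /eqP->.
- exists s0, p0; split=> //; first exact: eqxx.
  by move=> z /s0P /and3P[zb _ zc]; apply: inI.
- pose y := if c0 == p0 then c1 else c0.
  have yP : (y \in c) && (y != p0).
    by rewrite /y; case: (eqVneq c0 p0) => [<-|cp]; rewrite ?c1c ?c0c // eq_sym.
  have /andP[yc yp] := yP.
  have [||||s [t [tT Ls tb tp sP]]] := @off_bridge b p0 [pred z | (z \in c) && (z != p0)] u y
    ub _ yP; rewrite ?nb //.
  + by rewrite eq_sym nu.
  + by rewrite /= (negbTE uc).
  exists s, t; split=> // z /sP /and3P[zb zp]; rewrite /= zp andbT => zc; exact: inI.
- move=> w wI wu; have wc : w \notin c by move: wI; rewrite !inE negb_or => /andP[].
  have [||||s [t [tc Ls _ tw sP]]] := @off_bridge b w [pred z | z \in c] u c0 ub _ c0c;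
    rewrite ?nb // 1?eq_sym //.
    by apply: contraNneq wc => ->.
  exists s, t; split=> //.
  + by rewrite /= (tc : t \in c) /=; case: eqP.
  + by move=> z /sP /and3P[zb _ zc]; apply: inI.
  + by apply/negP => /sP; rewrite eqxx andbF.
move: pT qT => /= /eqP E /andP[qc qp]; subst p.
exists p0, q, s, t; split; first by split=> //; rewrite eq_sym.
rewrite -cat_cons; apply: (uniq_cat_disj (P := mem I)) => //.
- by move=> z; rewrite inE mem_cat => /or3P[/eqP->|/sI|/tI] //; exact: inI.
- by move=> z zbc; rewrite /= !inE -in_cons zbc.
Qed.

(** If a neighbour of [b] is missing from the circuit, then either the circuit can be
    improved or [p], [q] and [b] separate three common neighbours. *)
Lemma circuit_step b c : circuit_off b c ->
  [\/ forall u, b -- u -> u \in c, K3r_type G |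
      exists2 c', circuit_off b c' & count (adj b) c < count (adj b) c'].
Proof.
move=> Cc; have [cc Ubc c2] := Cc.
case: (boolP [forall u, b -- u ==> (u \in c)]) => [/forallP h|].
  by apply: Or31 => u; apply/implyP.
rewrite negb_forall => /existsP[u]; rewrite negb_imply => /andP[bu uc].
have ub : u != b by apply: contraTneq bu => ->; rewrite adj_irrefl.
have [p [q [Q1 [Q2 [[pc qc pq L1 L2] U]]]]] := circuit_fan Cc ub uc.
have Uc : uniq c by move: Ubc; rewrite cons_uniq => /andP[].
have [A [B [LA LB _ cE]]] := cycle_split cc Uc pc qc pq.
have {}U : uniq ((u :: Q1 ++ Q2) ++ b :: p :: A ++ q :: B).
  rewrite -(perm_uniq (s1 := (u :: Q1 ++ Q2) ++ b :: c)) //.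
  by rewrite perm_cat2l perm_cons.
have cntE : count (adj b) c = count (adj b) (p :: A ++ q :: B) by exact/permP.
case: (boolP (has (adj b) A)) => [/hasP[s sA bs]|]; last first.
  rewrite has_count -leqNgt => A0; apply: Or33.
  exists (p :: rev Q1 ++ u :: Q2 ++ q :: B).
    split; last by rewrite /= !size_cat /= !size_cat /= !addnS.
      rewrite -[cycle _ _]/(link p (rev Q1 ++ u :: Q2 ++ q :: B) p) !link_cat link_rev.
      by rewrite L1 L2.
    by ucount U.
  rewrite cntE /= !count_cat /= !count_cat /= count_rev bu; move: A0; clear; lia.
case: (boolP (has (adj b) B)) => [/hasP[t tB bt]|]; last first.
  rewrite has_count -leqNgt => B0; apply: Or33.
  exists (p :: A ++ q :: rev Q2 ++ u :: Q1).
    split; last by rewrite /= !size_cat /= !size_cat /= !addnS.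
      rewrite -[cycle _ _]/(link p (A ++ q :: rev Q2 ++ u :: Q1) p) !link_cat link_rev.
      by rewrite L1 L2 LA.
    by ucount U.
  rewrite cntE /= !count_cat /= !count_cat /= count_rev bu; move: B0; clear; lia.
case/splitPr: sA LA U {cE} cntE => A1 A2; rewrite link_cat => /andP[LA1 LA2] U cntE.
case/splitPr: tB LB U cntE => B1 B2; rewrite link_cat => /andP[LB1 LB2] U cntE.
(* A forbidden graph on s, b, t, p, with the link from [b] to [p] through [u], unless [s] and [t]
   are both adjacent to [p]; in the same way they are both adjacent to [q]. *)
have /nilP : nilp (rev A1 ++ B2).
  apply/negP => /negP n; apply: (@asp_forbids G s b t p (A2 ++ q :: B1) (u :: Q1) (rev A1) B2
    asp) => //.
  - by rewrite link_cat LA2.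
  - by rewrite link_cons bu.
  - by rewrite link_rev.
  - by ucount U.
  - by case: (A2).
have /nilP : nilp (A2 ++ rev B1).
  apply/negP => /negP n; apply: (@asp_forbids G s b t q (rev A1 ++ p :: rev B2) (u :: Q2) A2
    (rev B1) asp) => //.
  - by rewrite link_cat !link_rev LA1.
  - by rewrite link_cons bu.
  - by rewrite link_rev.
  - by ucount U.
  - by case: (rev A1).
case: A2 LA2 U cntE => //= LA2 U cntE /(congr1 rev); rewrite revK => /= E; subst B1.
case/lastP: A1 LA1 U cntE => [|A1 a]; last by rewrite rev_rcons.
move=> /= LA1 U cntE E; subst B2.
(* The circuit is p s q t, and [u] can take the place of [s]. *)
have /nilP EQ1 : nilp Q1.
  rewrite -[Q1]cats0.
  apply/negP => /negP n; apply: (@asp_forbids G u b t p (Q2 ++ [:: q]) [:: s] Q1 [::] asp) =>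
    //.
  - by rewrite link_cat L2.
  - by rewrite link_cons bs link_nil adj_sym -link_nil.
  - by ucount U.
  - by case: (Q2).
have /nilP EQ2 : nilp Q2.
  rewrite -[Q2]cats0.
  apply/negP => /negP n; apply: (@asp_forbids G u b t q (Q1 ++ [:: p]) [:: s] Q2 [::] asp) =>
    //.
  - by rewrite link_cat L1 link_nil adj_sym -link_nil.
  - by rewrite link_cons bs.
  - by rewrite link_nil adj_sym -link_nil.
  - by ucount U.
  - by case: (Q1).
subst Q1 Q2; rewrite !link_nil in L1 L2 LA1 LA2 LB1 LB2.
rewrite (adj_sym p) in LA1; rewrite (adj_sym q) in LB1.
have N : {in [:: u; s; t], forall x, [&& x -- b, x -- p & x -- q]}.
  by move=> x; rewrite !inE => /or3P[]/eqP->;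
    rewrite adj_sym ?bu ?bs ?bt ?L1 ?L2 ?LA1 ?LA2 ?LB1 ?LB2.
have Us : uniq [:: b; p; q; u; s; t] by ucount U.
have big c' : count (adj b) [:: p; q] + 3 <= count (adj b) c' ->
  count (adj b) c < count (adj b) c'.
  by rewrite cntE /= bs bt; clear; lia.
have [cn|n1] := boolP (connect (avoid [set p; q; b]) u s).
  by have [c' Cc' /big lt_c] := three_common_nbrs Us N cn; apply: Or33; exists c'.
have [cn|n2] := boolP (connect (avoid [set p; q; b]) u t).
  have Us' : uniq [:: b; p; q; u; t; s] by ucount U.
  have N' : {in [:: u; t; s], forall x, [&& x -- b, x -- p & x -- q]}.
    by move=> x; rewrite !inE => h; apply: N; move: h; rewrite !inE; do 3!case: eqP.
  by have [c' Cc' /big lt_c] := three_common_nbrs Us' N' cn; apply: Or33; exists c'.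
have [cn|n3] := boolP (connect (avoid [set p; q; b]) s t).
  have Us' : uniq [:: b; p; q; s; t; u] by ucount U.
  have N' : {in [:: s; t; u], forall x, [&& x -- b, x -- p & x -- q]}.
    by move=> x; rewrite !inE => h; apply: N; move: h; rewrite !inE; do 3!case: eqP.
  by have [c' Cc' /big lt_c] := three_common_nbrs Us' N' cn; apply: Or33; exists c'.
apply: Or32.
have XE : [set p; q; b] =i [:: p; q; b] by move=> z; rewrite !inE orbA.
have nX z : z \in [:: u; s; t] -> z \notin [set p; q; b].
  rewrite XE => zE; apply/negP => zX.
  move: Us; rewrite -(perm_uniq (s1 := [:: p; q; b] ++ [:: u; s; t])); last first.
    by apply/permP => a /=; clear; lia.
  by rewrite cat_uniq => /and3P[_ /hasPn/(_ _ zE)]; rewrite /= zX.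
apply: (separated_K3r G3 asp G7 _ XE _ _ _ n1 n2 n3); try by apply: nX; rewrite !inE eqxx ?orbT.
by ucount Us.
Qed.

Lemma circuit_thru_nbrs b : K3r_type G \/ exists2 c, circuit_off b c & forall u, b -- u ->
  u \in c.
Proof.
have [c0 Cc0] : exists c, circuit_off b c.
  have [v vb] : exists v, v != b.
    apply/existsP; rewrite -negb_forall; apply/negP => /forallP h.
    have : #|G| <= #|[set b]| by rewrite -cardsT subset_leq_card //; apply/subsetP => z _;
      rewrite inE; exact: h z.
    by rewrite cards1 => /(leq_trans G7).
  have [w] : exists w, w \in [set y | v -- y] :\ b.
    apply/set0Pn; rewrite -card_gt0; have := cardsD1 b [set y | v -- y].
    have := min_degree G3 v; rewrite /degree; case: (_ \in _); clear; lia.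
  rewrite !inE => /andP[wb vw]; exists [:: v; w]; split=> //.
    by rewrite /= vw adj_sym vw.
  by rewrite !cons_uniq !inE negb_or eq_sym vb eq_sym wb /=; rewrite andbT;
    apply: contraTneq vw => ->; rewrite adj_irrefl.
suff main n : forall c, circuit_off b c -> #|G| - count (adj b) c < n ->
    K3r_type G \/ exists2 c, circuit_off b c & forall u, b -- u -> u \in c.
  exact: main Cc0 (ltnSn _).
elim: n => // n IHn c Cc lt_n.
have [h|h|[c' Cc' lt_c]] := circuit_step Cc; [by right; exists c|by left|].
apply: (IHn c' Cc').
have : count (adj b) c' <= #|G|.
  have [_ U _] := Cc'; apply: leq_trans (count_size _ _) _;
    apply: leq_trans (max_card (mem c')).
  by rewrite (card_uniqP _) //; move: U; rewrite cons_uniq => /andP[].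
by move: lt_c lt_n; clear; lia.
Qed.

End Circuits.

(** * Crossing a circuit, and vertices of degree three *)

Section Theta.
Variable G : sgraph.
Hypotheses (G3 : k_connected 3 G) (asp : ASP G) (G7 : 6 < #|G|).

(** The neighbours [a] and [c] of [b] lie on one side of the chord or link [R] and [b]
    reaches [p] through [s] on the other side. If [a] and [c] are not consecutive, this is a
    forbidden graph unless both are adjacent to [p] on the circuit formed by [B] and [R]. *)
Lemma theta_cross (b p q : G) (A B R : seq G) (s : G) (X : seq G) (a : G) (Y : seq G) (c : G)
  (Z : seq G) :
    link p A q -> link q B p -> link p R q -> uniq (b :: p :: q :: A ++ B ++ R) ->
    s \in A -> b -- s -> q :: B = X ++ a :: Y ++ c :: Z -> b -- a -> b -- c ->
  nilp Y || [&& nilp X, nilp R & nilp Z].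
Proof.
move=> LA LB LR U /splitPr sA bs; case: sA LA U => A1 A2; rewrite link_cat => /andP[LA1 LA2] U.
move=> EB ba bc; apply/negPn/negP; rewrite negb_or => /andP[nY].
case: X EB => [|x X] /= [Eq EB] nX.
  subst q B; rewrite link_cat in LB; case/andP: LB => LY LZ.
  apply: (@asp_forbids G a b c p Y (s :: rev A1) (rev R) Z asp) => //.
  - by rewrite link_cons bs link_rev.
  - by rewrite link_rev.
  - by ucount U.
  - by move: nX; rewrite /nilp size_cat size_rev addn_eq0.
subst x B; rewrite !link_cat in LB; case/and3P: LB => LX LY LZ.
apply: (@asp_forbids G a b c p Y (s :: rev A1) (rev X ++ q :: rev R) Z asp) => //.
- by rewrite link_cons bs link_rev.
- by rewrite link_cat !link_rev LX.
- by ucount U.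
- by case: (rev X).
Qed.

(** Here [s] is adjacent to [p] and plays the part of the vertex with two unsubdivided
    edges, to [p] and to [b]; [t1] and [t2] supply the links from [b] to [q] and from [b] to
    [p]. *)
Lemma theta_two_two (b p q s : G) (A X : seq G) (t1 : G) (Y : seq G) (t2 : G) (Z R : seq G) :
    link p (s :: A) q -> link q (X ++ t1 :: Y ++ t2 :: Z) p -> link p R q ->
    uniq (b :: p :: q :: (s :: A) ++ (X ++ t1 :: Y ++ t2 :: Z) ++ R) ->
    b -- s -> b -- t1 -> b -- t2 -> nilp A.
Proof.
rewrite link_cons !link_cat => /andP[ps LA] /and3P[LX _ LZ] LR U bs bt1 bt2.
apply/negPn/negP => nA.
apply: (@asp_forbids G p s b q (rev Z ++ [:: t2]) A R (t1 :: rev X) asp) => //.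
- by rewrite adj_sym.
- by rewrite adj_sym.
- by rewrite link_cat link_rev LZ link_nil adj_sym.
- by rewrite link_cons bt1 link_rev.
- by ucount U.
- by case: (rev Z).
- by case: (R).
Qed.

Lemma link_last (p : G) R q : link p R q -> exists2 z, z \in p :: R & z -- q.
Proof. by rewrite /link rcons_path => /andP[_ h]; exists (last p R); rewrite ?mem_last. Qed.

Lemma set3_list (T : finType) (S : {set T}) : #|S| = 3 ->
  exists x y z, uniq [:: x; y; z] /\ S =i [:: x; y; z].
Proof.
rewrite cardE => S3; have := enum_uniq (mem S); have SE := mem_enum (mem S).
case: (enum S) S3 SE => [|x [|y [|z []]]] // _ SE U; by exists x, y, z; split.
Qed.

(** A link joining two of the arcs between the neighbours would make a theta in which a
    whole arc separates two neighbours on one side, against [theta_cross]; so the neighbours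
    of [b] separate [b] and two of the arcs from one another. *)
Lemma degree3_independent (b : G) : degree b = 3 -> (forall u v, b -- u -> b -- v ->
  ~~ (u -- v)) -> K3r_type G.
Proof.
move=> d3 ind; have [//|[c [cc Ubc _] cN]] := circuit_thru_nbrs G3 asp G7 b.
have [n1 [n2 [n3 [Un NE]]]] := set3_list d3.
have bn x : (b -- x) = (x \in [:: n1; n2; n3]) by rewrite -NE inE.
have [b1 b2 b3] : [/\ b -- n1, b -- n2 & b -- n3] by split; rewrite bn !inE eqxx ?orbT.
have Uc : uniq c by move: Ubc; rewrite cons_uniq => /andP[].
have n12 : n1 != n2 by move: Un; rewrite cons_uniq inE negb_or => /andP[/andP[]].
have [n13 n23] : n3 != n1 /\ n3 != n2.
  by move: Un; rewrite !cons_uniq !inE !negb_or !(eq_sym n3) => /and3P[/andP[_ ->] ->].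
have [A [B [LA LB U0 cE]]] := cycle_split cc Uc (cN _ b1) (cN _ b2) n12.
have U : uniq (b :: n1 :: A ++ n2 :: B) by rewrite -(perm_uniq (s1 := b :: c)) ?perm_cons.
have n3AB : (n3 \in A) || (n3 \in B).
  have := cN _ b3; rewrite (perm_mem cE) !inE mem_cat inE (negbTE n13) (negbTE n23) /=.
  by [].
have [B1 [B2 [B3 [m1 [m2 [Um mE L1 L2 L3]]]]]] : exists B1 B2 B3 m1 m2,
  [/\ uniq (b :: n3 :: m1 :: m2 :: B1 ++ B2 ++ B3), [:: m1; m2; n3] =i [:: n1; n2; n3],
    link m1 B1 m2, link m2 B2 n3 & link n3 B3 m1].
  case/orP: n3AB => /splitPr n3in.
    case: n3in LA U {U0 cE} => A1 A2; rewrite link_cat => /andP[LA1 LA2] U.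
    exists B, A1, A2, n2, n1; split=> //; first by ucount U.
    by move=> x; rewrite !inE orbCA.
  case: n3in LB U {U0 cE} => B1 B2; rewrite link_cat => /andP[LB1 LB2] U.
  by exists A, B1, B2, n1, n2; split=> //; ucount U.
have bm x : (b -- x) = (x \in [:: m1; m2; n3]) by rewrite mE bn.
have [bm1 bm2] : b -- m1 /\ b -- m2 by split; rewrite bm !inE eqxx ?orbT.
have nil_false x y S : link x S y -> b -- x -> b -- y -> ~~ nilp S.
  by move=> LS bx by_; apply/negP => /nilP S0; have := ind _ _ bx by_; rewrite -link_nil -S0 LS.
have nB1 := nil_false _ _ _ L1 bm1 bm2.
have nB2 := nil_false _ _ _ L2 bm2 b3.
have nB3 := nil_false _ _ _ L3 b3 bm1.
pose X := [set x | b -- x].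
have XE : X =i [:: m1; m2; n3] by move=> x; rewrite inE bm.
have bX : b \notin X by rewrite inE adj_irrefl.
have isol v : connect (avoid X) b v -> v = b.
  case/connectP=> -[_ ->//|w t /= /andP[/and3P[_ wX bw] _] _].
  by rewrite inE bw in wX.
case E1 : B1 nB1 => [//|v B1'] _; case E2 : B2 nB2 => [//|w B2'] nB2.
have vB1 : v \in B1 by rewrite E1 mem_head.
have wB2 : w \in B2 by rewrite E2 mem_head.
have notX z : z \in B1 ++ B2 ++ B3 -> (z \notin X) && (z != b).
  move=> zB; have : uniq ([:: b; m1; m2; n3] ++ B1 ++ B2 ++ B3) by ucount Um.
  rewrite cat_uniq => /and3P[_ /hasPn/(_ _ zB) + _].
  by rewrite XE /= inE negb_or andbC.
have /andP[vX vb] : (v \notin X) && (v != b) by apply: notX; rewrite mem_cat vB1.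
have /andP[wX wb] : (w \notin X) && (w != b) by apply: notX; rewrite !mem_cat wB2 orbT.
apply: (@separated_K3r G G3 asp X m1 m2 n3 b v w) => //.
- by ucount Um.
- by apply: contra vb => /isol->.
- by apply: contra wb => /isol->.
(* The circuit is m1 B1 m2 B2 n3 B3; a link from [B1] to the other arcs gives a theta in which two
   of the neighbours lie on one side, separated by a whole arc. *)
apply/negP => cvw; pose S := [pred z | z \in B1]; pose T := [pred z | z \in b :: B2 ++ B3].
have dST z : S z -> ~~ T z.
  rewrite /S /T /= => zB1; have : uniq (B1 ++ b :: B2 ++ B3) by ucount Um.
  by rewrite cat_uniq => /and3P[_ /hasPn h _]; apply: contraL zB1 => /h.
have [||p [R [q [pB1 qT LR UR [pX qX RP]]]]] := connect_bridge (S := S) (T := T) cvw _ _ vX dST.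
- by [].
- by rewrite /T /= inE mem_cat wB2 orbT.
have pB1' : p \in B1 by [].
have qB : q \in B2 ++ B3.
  move: qT; rewrite /T /= inE => /predU1P[qb|//]; subst q.
  have [z zR zb] := link_last LR.
  have : z \in X by rewrite inE adj_sym.
  by move: zR; rewrite inE => /predU1P[->|/RP/and3P[_ _ /negbTE->//]]; rewrite (negbTE pX).
have UU : uniq (R ++ b :: n3 :: m1 :: m2 :: B1 ++ B2 ++ B3).
  apply: (uniq_cat_disj (P := mem R)) => //; first by ucount UR.
  move=> z; apply: contraTN => /RP /and3P[]; rewrite /S /T /= XE !inE !mem_cat !negb_or.
  by move=> /negbTE-> /and3P[/negbTE-> /negbTE-> /negbTE->] /and3P[/negbTE-> /negbTE->
    /negbTE->].
clear cE; move: pB1'; clear pB1 => /splitPr pB1.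
case: {E1 vB1 notX dST RP S T qT} pB1 L1 Um UU => P1 P2; rewrite link_cat =>
  /andP[LP1 LP2] Um UU.
move: qB; rewrite mem_cat => /orP[] /splitPr qB.
  rewrite -E2 in nB2.
  case: {E2 wB2} qB L2 nB2 Um UU => Q1 Q2; rewrite link_cat => /andP[LQ1 LQ2] nB2 Um UU.
  have := @theta_cross b p q (P2 ++ m2 :: Q1) (Q2 ++ n3 :: B3 ++ m1 :: P1) R m2
    (q :: Q2) n3 B3 m1 P1.
  rewrite !link_cat LP1 LP2 LQ1 LQ2 L3 LR mem_cat mem_head orbT bm1 bm2 b3 (negbTE nB3) /=.
  have -> : uniq [:: b, p, q & (P2 ++ m2 :: Q1) ++ (Q2 ++ n3 :: B3 ++ m1 :: P1) ++ R] by ucount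
    UU.
  by move=> /(_ isT isT isT isT isT isT erefl isT isT).
case: qB L3 nB3 Um UU => Q1 Q2; rewrite link_cat => /andP[LQ1 LQ2] nB3 Um UU.
have := @theta_cross b p q (rev P1 ++ m1 :: rev Q2) (rev Q1 ++ n3 :: rev (w :: B2') ++ m2 ::
  rev P2) R m1
    (q :: rev Q1) n3 (rev (w :: B2')) m2 (rev P2).
rewrite !link_cat !link_rev LP1 LP2 LQ1 LQ2 -E2 L2 LR mem_cat mem_head orbT bm1 bm2 b3 /=.
have -> : uniq [:: b, p, q & (rev P1 ++ m1 :: rev Q2) ++ (rev Q1 ++ n3 :: rev B2 ++ m2 :: rev
  P2) ++ R] by ucount UU.
by move=> /(_ isT isT isT isT isT isT erefl isT isT); rewrite E2 /nilp size_rev.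
Qed.

End Theta.

(** * Vertices of degree at least four: arcs free of neighbours *)

Lemma has_split (T : eqType) (a : pred T) l : has a l ->
  exists X x Y, [/\ l = X ++ x :: Y, a x & ~~ has a X].
Proof.
elim: l => //= x l IHl; case: (boolP (a x)) => [ax _|nax /IHl[X [y [Y [-> ay nX]]]]].
  by exists [::], x, l.
by exists (x :: X), y, Y; split; rewrite //= negb_or nax.
Qed.

Lemma count2_split (T : eqType) (a : pred T) l : 2 <= count a l ->
  exists X x Y y W, [/\ l = X ++ x :: Y ++ y :: W, a x & a y].
Proof.
move=> c2; have /has_split[X [x [Z [E ax nX]]]] : has a l by rewrite has_count (ltn_trans _ c2).
have /has_split[Y [y [W [E' ay _]]]] : has a Z.
  move: c2 nX; rewrite E count_cat /= ax !has_count; clear; lia.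
by exists X, x, Y, y, W; rewrite E E'.
Qed.

Section Hub.
Variable G : sgraph.
Hypotheses (G3 : k_connected 3 G) (asp : ASP G) (G7 : 6 < #|G|).
Variable b : G.
Hypothesis d4 : 4 <= degree b.

Lemma count_nbrs (F : seq G) : (forall u, b -- u -> u \in F) -> 4 <= count (adj b) F.
Proof.
move=> NF; apply: leq_trans d4 _; rewrite /degree -size_filter.
apply: leq_trans (card_size _); apply: subset_leq_card; apply/subsetP => u.
by rewrite inE mem_filter => bu; rewrite bu NF.
Qed.

(** Three neighbours of [b] on one side: the pairs formed with the last one use up the tight
    exception of [theta_cross] and fix the positions of all of them. *)
Lemma cross_three (q t : G) (B R Z : seq G) :
    (forall X a Y c Z', q :: B ++ t :: Z = X ++ a :: Y ++ c :: Z' -> b -- a -> b -- c ->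
       nilp Y || [&& nilp X, nilp R & nilp Z']) ->
    b -- t -> 2 <= count (adj b) (q :: B) ->
  exists y, [/\ B = [:: y], b -- q, b -- y, nilp R & nilp Z].
Proof.
move=> cross bt /count2_split[X [a1 [Y [a2 [W [E ba1 ba2]]]]]].
have E' : q :: B ++ t :: Z = X ++ a1 :: Y ++ a2 :: W ++ t :: Z.
  by rewrite -cat_cons E -catA /= -catA.
have := cross X a1 (Y ++ a2 :: W) t Z; rewrite E' -[(Y ++ _) ++ _]catA => /(_ erefl ba1 bt).
have -> : nilp (Y ++ a2 :: W) = false by case: (Y).
move=> /and3P[/nilP X0 R0 Z0]; subst X.
have := cross (a1 :: Y) a2 W t Z; rewrite E' => /(_ erefl ba2 bt); rewrite orbF => /nilP W0.
have := cross [::] a1 Y a2 (W ++ t :: Z); rewrite E' => /(_ erefl ba1 ba2);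
  rewrite W0 /= andbF orbF.
move=> /nilP Y0; move: E; rewrite Y0 W0 => -[-> ->].
by exists a2.
Qed.

(** The path [s M t] carries all neighbours of [b], and the arc closes it to a circuit. A
    fan from [p] to [t] and to some [q] in [M] is a crossing in which [p] is adjacent to
    [s]. *)
Lemma arc_forces_four s t M p Arc :
    link s M t -> link s (p :: Arc) t -> uniq (b :: s :: t :: M ++ p :: Arc) ->
    b -- s -> b -- t -> (forall u, b -- u -> u \in s :: t :: M) ->
  exists x y, [/\ M = [:: x; y], b -- x, b -- y & (p -- x /\ p -- t) \/ p -- y].
Proof.
move=> LM; rewrite link_cons => /andP[sp LArc] U bs bt NF.
pose I := ~: [set z | z \in b :: s :: t :: M].
have ArcI : {subset p :: Arc <= I}.
  move=> z zA; have : uniq ((b :: s :: t :: M) ++ p :: Arc) by ucount U.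
  by rewrite cat_uniq inE inE => /and3P[_ /hasPn/(_ _ zA)].
have pI : p \in I by apply: ArcI; rewrite mem_head.
have Ib z : z \in I -> ~~ (b -- z).
  by apply: contraTN => /NF; rewrite !inE negbK => ->; rewrite orbT.
have bsb : b != s by apply: contraTneq bs => <-; rewrite adj_irrefl.
have bI : b \notin I by rewrite !inE eqxx.
have nI z : z \in t :: M -> z \notin I by rewrite !inE negbK => ->; rewrite !orbT.
have reach w : w != p -> w != b -> exists R q, [/\ q \in t :: M, q != w, link p R q,
    {subset R <= I} & w \notin R].
  move=> wp wb; pose T := [pred z | z \in b :: t :: M].
  have dST z : pred1 p z -> ~~ T z.
    by move=> /eqP->; move: pI; rewrite /T /= !inE !negb_or => /and4P[-> _ -> ->].
  have [|||p' [R [q [/eqP-> qT LR UR [_ qA RP]]]]] :=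
     @bridge3 G [set s; w] (pred1 p) T p b G3 _ (eqxx _) (mem_head _ _) _ _ dST.
  - by rewrite cards2; case: (_ != _).
  - by rewrite !inE negb_or eq_sym andbC eq_sym wp; apply: contraTneq sp => ->;
    rewrite adj_irrefl.
  - by rewrite !inE negb_or bsb eq_sym.
  have RI : {subset R <= I}.
    by move=> z /RP /and3P[_]; rewrite /T /= !inE !negb_or => /and3P[-> -> ->] /andP[-> _].
  exists R, q; split=> //.
  - move: qT; rewrite /T /= inE => /predU1P[E|//]; subst q.
    have [z zR zb] := link_last LR; have /Ib : z \in I by move: zR; rewrite inE =>
      /predU1P[->|/RI].
    by rewrite adj_sym zb.
  - by move: qA; rewrite !inE negb_or => /andP[].
  - by apply/negP => /RP; rewrite !inE eqxx orbT !andbF.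
have tb : t != b by apply: contraTneq bt => ->; rewrite adj_irrefl.
have pt : p != t by apply: contraTneq pI => ->; apply: nI; rewrite mem_head.
have [||||Z [t' [R [q [/eqP-> qM LZ LR [ZI RI UZR]]]]]] :=
  @fan G I p (pred1 t) [pred z | z \in M] pI.
- by move=> z zI /=; apply: contraTN zI => /orP[/eqP->|zM]; apply: nI;
  rewrite ?mem_head // inE zM orbT.
- exists Arc, t; split=> //; first exact: eqxx.
  by move=> z zA; apply: ArcI; rewrite inE zA orbT.
- have [|R [q [qM qt LR RI _]]] := reach t _ tb; first by rewrite eq_sym.
  by exists R, q; split=> //=; move: qM; rewrite inE (negbTE qt).
- move=> w wI wp; have [|R [q [qM qw LR RI wR]]] := reach w wp;
  first by apply: contraTneq wI => ->.
  by exists R, q; split=> //; move: qM; rewrite /= inE.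
have cM : 2 <= count (adj b) M.
  have := count_nbrs NF; rewrite /= bs bt; clear; lia.
have {}U : uniq ((p :: Z ++ R) ++ b :: s :: t :: M).
  apply: (uniq_cat_disj (P := mem I)) => //.
  - by ucount U.
  - by move=> z; rewrite inE mem_cat => /or3P[/eqP->|/ZI|/RI].
  - by move=> z zF; rewrite /= !inE -!in_cons zF.
clear reach UZR ZI RI nI Ib ArcI pI bI I NF pt tb.
move: qM cM => /= /splitPr qM cM; case: qM LM U cM => A' B1; rewrite link_cat =>
  /andP[LA LB] U cM.
have LsA : link p (s :: A') q by rewrite link_cons adj_sym sp.
have LBZ : link q (B1 ++ t :: rev Z) p by rewrite link_cat LB link_rev.
have Uth : uniq (b :: p :: q :: (s :: A') ++ (B1 ++ t :: rev Z) ++ R) by ucount U.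
have LrA : link q (rev A' ++ [:: s]) p by rewrite link_cat link_rev LA link_nil.
have LrBZ : link p (Z ++ t :: rev B1) q by rewrite link_cat LZ link_rev.
have Uth' : uniq (b :: p :: q :: (Z ++ t :: rev B1) ++ (rev A' ++ [:: s]) ++ R) by ucount U.
(* The circuit is p s A' q B1 t Z.  Either [s] is adjacent to [q], and the other neighbours of [b]
   are on the side of [t], or by [theta_two_two] they are on the side of [s]. *)
case: (boolP (nilp A')) => [/nilP A0|nA].
  subst A'; have [X a Y c Z'|y [EB bq by_ R0 Z0]] := @cross_three q t B1 R (rev Z) _ bt cM.
    exact: (theta_cross asp LsA LBZ LR Uth (mem_head s [::]) bs).
  exists q, y; split=> //=; first by rewrite EB.
  left; move: LR LZ; rewrite (nilP R0).
  have -> : Z = [::] by apply/nilP; move: Z0; rewrite /nilp size_rev.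
  by rewrite !link_nil.
have notB1 : ~~ has (adj b) B1.
  apply/negP => /has_split[X [t1 [Y [E bt1 _]]]]; subst B1.
  case/negP: nA; move: LBZ Uth; rewrite -catA => LBZ Uth.
  exact: (theta_two_two asp LsA LBZ LR Uth bs bt1 bt).
have cA : 2 <= count (adj b) (q :: rev A').
  by move: cM notB1; rewrite has_count count_cat /= count_rev; clear; lia.
have tZ : t \in Z ++ t :: rev B1 by rewrite mem_cat mem_head orbT.
have [X a Y c Z'|y [EA bq by_ R0 _]] := @cross_three q s (rev A') R [::] _ bs cA.
  exact: (theta_cross asp LrBZ LrA LR Uth' tZ bt).
have {}EA : A' = [:: y] by rewrite -(revK A') EA.
have B0 : nilp B1.
  have sA : s \in s :: A' by rewrite mem_head.
  have := theta_cross asp LsA LBZ LR Uth sA bs (X := [::]) (erefl (q :: B1 ++ t :: rev Z)) bq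
    bt.
  case/orP=> // /and3P[_ _ /nilP Z0]; rewrite -[B1]revK /nilp size_rev.
  have {}Z0 : Z = [::] by rewrite -[Z]revK Z0.
  subst Z A'; rewrite /= in LrBZ LrA Uth'.
  exact: (@theta_two_two G asp b p q t (rev B1) [::] y [::] s [::] R LrBZ LrA LR Uth' bt by_
    bs).
exists y, q; split=> //; first by rewrite EA (nilP B0).
by right; move: LR; rewrite (nilP R0) link_nil.
Qed.

(** Apply the previous lemma at both ends of the arc. If it gives adjacencies to different
    inner vertices of the path for different ends of the arc, the two ends yield a forbidden
    graph. *)
Lemma arc_forces_tripod s t M Arc :
    link s M t -> link s Arc t -> ~~ nilp Arc -> uniq (b :: s :: t :: M ++ Arc) ->
    b -- s -> b -- t -> (forall u, b -- u -> u \in s :: t :: M) ->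
  exists x y, [/\ M = [:: x; y], b -- x, b -- y &
    exists p, [/\ p \in Arc, p -- s, p -- t & p -- x \/ p -- y]].
Proof.
move=> LM LArc nArc U bs bt NF.
case: Arc nArc LArc U => // p Arc _ LArc U.
have [x [y [EM bx by_ pE]]] := arc_forces_four LM LArc U bs bt NF.
exists x, y; split=> //.
have ps : p -- s by move: LArc; rewrite link_cons adj_sym => /andP[].
case: pE => [[px pt]|py]; first by exists p; split; rewrite ?mem_head //; left.
have LM' : link t (rev M) s by rewrite link_rev.
have [p' [Arc' EA]] : exists p' Arc', rev (p :: Arc) = p' :: Arc'.
  by case: (rev (p :: Arc)) (size_rev (p :: Arc)) => [//|p' Arc' _]; exists p', Arc'.
have LA' : link t (p' :: Arc') s by rewrite -EA link_rev.
have U' : uniq (b :: t :: s :: rev M ++ p' :: Arc') by rewrite -EA; ucount U.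
have NF' u : b -- u -> u \in t :: s :: rev M.
  by move=> /NF; rewrite !inE mem_rev orbCA.
have [x' [y' [EM' _ _ pE']]] := arc_forces_four LM' LA' U' bt bs NF'.
move: EM'; rewrite EM => -[E1 E2]; subst x' y'.
have p't : p' -- t by move: LA'; rewrite link_cons adj_sym => /andP[].
have p'A : p' \in p :: Arc by rewrite -mem_rev EA mem_head.
case: pE' => [[p'y p's]|p'x]; first by exists p'; split=> //; right.
case/lastP: Arc EA p'A LArc U {LA' U' LM' NF'} => [|Arc r]; last first.
  rewrite -rcons_cons rev_rcons => -[Er _] _ LArc U; subst r.
  move: LArc; rewrite rcons_cons link_cons -cats1 link_cat => /and3P[_ LArc _].
  (* The ends p and p' of the arc differ; [t] is the vertex with two unsubdivided edges, to p'
     and to [b]. *)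
  exfalso; subst M; move: LM; rewrite !link_cons link_nil => /and3P[_ _ yt].
  apply: (@asp_forbids G p' t b p [:: x] [:: y] (rev Arc) [:: s] asp) => //.
  - by rewrite adj_sym.
  - by rewrite adj_sym.
  - by rewrite link_cons link_nil p'x adj_sym.
  - by rewrite link_cons link_nil adj_sym yt adj_sym.
  - by rewrite link_rev.
  - by rewrite link_cons link_nil bs adj_sym.
  - by ucount U.
  - by case: (rev Arc).
case=> Ep _ _ _ _; subst p'; exists p; split; rewrite ?mem_head //; by left.
Qed.

End Hub.

Section Hub.
Variable G : sgraph.
Hypotheses (G3 : k_connected 3 G) (asp : ASP G) (G7 : 6 < #|G|).

Lemma link_join (O : {set G}) v R1 q1 R2 q2 : v \in O -> link v R1 q1 -> link v R2 q2 ->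
    {subset R1 <= O} -> {subset R2 <= O} ->
  exists S, [/\ link q1 S q2, {subset S <= O}, ~~ nilp S & uniq S].
Proof.
move=> vO L1 L2 R1O R2O.
have L : link q1 (rev R1 ++ v :: R2) q2 by rewrite link_cat link_rev L1.
have sO : {subset rev R1 ++ v :: R2 <= O}.
  by move=> z; rewrite mem_cat mem_rev inE => /or3P[/R1O|/eqP->|/R2O].
case E: (rev R1 ++ v :: R2) L sO => [|h l]; first by move: E; case: (rev R1).
rewrite link_cons /link rcons_path => /and3P[q1h Pl lq2] sO.
case/shortenP: Pl lq2 => l' Pl' Ul' sub lq2.
exists (h :: l'); split=> //; first by rewrite /= q1h rcons_path Pl'.
by move=> z; rewrite inE => /predU1P[->|/sub zl]; apply: sO; rewrite inE ?eqxx // zl orbT.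
Qed.

Variable b : G.
Hypothesis d4 : 4 <= degree b.

(** The vertices listed form the only graph of this kind: any further vertex [v] has links
    avoiding [p] to two of the [f]s, and a link through it either prolongs the path carrying
    the neighbours of [b], contradicting [arc_forces_four], or crosses the circuit. *)
Lemma four_rim_small p f1 f2 f3 f4 :
    uniq [:: b; p; f1; f2; f3; f4] -> f1 -- f2 -> f2 -- f3 -> f3 -- f4 ->
    b -- f1 -> b -- f2 -> b -- f3 -> b -- f4 -> (forall u, b -- u -> u \in [:: f1; f2; f3;
      f4]) ->
    p -- f1 -> p -- f2 -> p -- f4 -> False.
Proof.
move=> UQ e12 e23 e34 b1 b2 b3 b4 NF p1 p2 p4.
pose Q := [:: b; p; f1; f2; f3; f4]; pose O := ~: [set z | z \in Q].
have [v vO] : exists v, v \in O.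
  apply/set0Pn; rewrite -card_gt0 -subn_gt0; have := cardsC [set z | z \in Q].
  have : #|[set z | z \in Q]| <= 6 by rewrite cardsE; apply: card_size.
  by rewrite -/O; move: G7; clear; lia.
have OQ z : z \in O -> z \notin Q by rewrite !inE.
have Ob z : z \in O -> ~~ (b -- z).
  by apply: contraTN => /NF; rewrite !inE negbK => ->; rewrite !orbT.
pose att w := exists2 R, link v R w & {subset R <= O}.
have join w1 w2 : att w1 -> att w2 -> exists S, [/\ link w1 S w2, ~~ nilp S & uniq (S ++ Q)].
  move=> [R1 L1 R1O] [R2 L2 R2O]; have [S [LS SO nS US]] := link_join vO L1 L2 R1O R2O.
  exists S; split=> //; apply: (uniq_cat_disj (P := mem O)) => //.
  by move=> z zQ; rewrite /= /O in_setC negbK inE.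
have reach w1 w2 : w1 != b -> w2 != b -> w1 \in Q -> w2 \in Q -> exists w, [/\ att w, w \in Q,
  w != b & (w != w1) && (w != w2)].
  move=> w1b w2b w1Q w2Q; pose T := [pred z | z \in Q].
  have dST z : pred1 v z -> ~~ T z by move=> /eqP->; exact: OQ.
  have nv w : w \in Q -> v != w by move=> wQ; apply: contraTneq wQ => <-; exact: OQ.
  have [|||v' [R [q [/eqP-> qT LR UR [_ qA RP]]]]] :=
     @bridge3 G [set w1; w2] (pred1 v) T v b G3 _ (eqxx _) (mem_head _ _) _ _ dST.
  - by rewrite cards2; case: (_ != _).
  - by rewrite !inE negb_or !nv.
  - by rewrite !inE negb_or !(eq_sym b) w1b.
  have RO : {subset R <= O} by move=> z /RP /and3P[_]; rewrite /T /= !inE.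
  exists q; split=> //; first by exists R.
  - apply/eqP => qb; subst q; have [z zR zb] := link_last LR.
    have /Ob : z \in O by move: zR; rewrite inE => /predU1P[->|/RO].
    by rewrite adj_sym zb.
  - by move: qA; rewrite !inE negb_or.
have big s t M : link s M t -> p -- s -> p -- t -> uniq (b :: s :: t :: M ++ [:: p]) ->
    b -- s -> b -- t -> {subset [:: f1; f2; f3; f4] <= s :: t :: M} -> size M <= 2.
  move=> LM ps pt U bs bt sub.
  have LA : link s [:: p] t by rewrite link_cons link_nil adj_sym ps.
  have NF' u : b -- u -> u \in s :: t :: M by move/NF/sub.
  by have [x [y [-> _]]] := arc_forces_four G3 asp d4 LM LA U bs bt NF'.
(* A link between consecutive vertices prolongs the path f1 f2 f3 f4. *)
have n12 S : link f1 S f2 -> ~~ nilp S -> uniq (S ++ Q) -> False.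
  move=> LS nS U; have := big f1 f4 (S ++ [:: f2; f3]).
  rewrite link_cat LS !link_cons link_nil e23 e34 p1 p4 b1 b4 => /(_ isT isT isT).
  have -> : uniq [:: b, f1, f4 & (S ++ [:: f2; f3]) ++ [:: p]] by ucount U.
  have sub : {subset [:: f1; f2; f3; f4] <= [:: f1, f4 & S ++ [:: f2; f3]]}.
    by move=> z; rewrite !inE mem_cat !inE => /or4P[] ->; rewrite ?orbT.
  by move=> /(_ isT isT isT sub); case: (S) nS => //= ? ? _; rewrite size_cat addn2.
have n34 S : link f3 S f4 -> ~~ nilp S -> uniq (S ++ Q) -> False.
  move=> LS nS U; have := big f1 f4 (f2 :: f3 :: S).
  rewrite !link_cons LS e12 e23 p1 p4 b1 b4 => /(_ isT isT isT).
  have -> : uniq [:: b, f1, f4 & (f2 :: f3 :: S) ++ [:: p]] by ucount U.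
  have sub : {subset [:: f1; f2; f3; f4] <= [:: f1, f4, f2, f3 & S]}.
    by move=> z; rewrite !inE => /or4P[] ->; rewrite ?orbT.
  by move=> /(_ isT isT isT sub); case: (S) nS.
have n23 S : link f2 S f3 -> ~~ nilp S -> uniq (S ++ Q) -> False.
  move=> LS nS U; have := big f1 f4 (f2 :: S ++ [:: f3]).
  rewrite !link_cons link_cat LS link_nil e12 e34 p1 p4 b1 b4 => /(_ isT isT isT).
  have -> : uniq [:: b, f1, f4 & (f2 :: S ++ [:: f3]) ++ [:: p]] by ucount U.
  have sub : {subset [:: f1; f2; f3; f4] <= [:: f1, f4, f2 & S ++ [:: f3]]}.
    by move=> z; rewrite !inE mem_cat !inE => /or4P[] ->; rewrite ?orbT.
  by move=> /(_ isT isT isT sub); case: (S) nS => //= ? ? _; rewrite size_cat addn1.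
(* The path f2 f1 S f3 f4 carries the neighbours of [b], and [p] joins its ends. *)
have n13 S : link f1 S f3 -> ~~ nilp S -> uniq (S ++ Q) -> False.
  move=> LS nS U; have := big f2 f4 (f1 :: S ++ [:: f3]).
  rewrite !link_cons link_cat LS link_nil adj_sym e12 e34 p2 p4 b2 b4 => /(_ isT isT isT).
  have -> : uniq [:: b, f2, f4 & (f1 :: S ++ [:: f3]) ++ [:: p]] by ucount U.
  have sub : {subset [:: f1; f2; f3; f4] <= [:: f2, f4, f1 & S ++ [:: f3]]}.
    by move=> z; rewrite !inE mem_cat !inE => /or4P[] ->; rewrite ?orbT.
  by move=> /(_ isT isT isT sub); case: (S) nS => //= ? ? _; rewrite size_cat addn1.
(* The link itself can serve as the arc; its first vertex is then adjacent to [f2] or [f3]. *)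
have n14 S : link f1 S f4 -> ~~ nilp S -> uniq (S ++ Q) -> False.
  case: S => // w S LS _ U.
  have LM : link f1 [:: f2; f3] f4 by rewrite !link_cons link_nil e12 e23.
  have Uw : uniq ([:: w] ++ Q) by ucount U.
  have f1w : f1 -- w by move: LS; rewrite link_cons => /andP[].
  have [| |x [y [[<- <-] _ _ wE]]] := arc_forces_four G3 asp d4 LM LS _ b1 b4.
  - by ucount U.
  - by move=> u /NF; rewrite !inE => /or4P[] ->; rewrite ?orbT.
  case: wE => [[w2 _]|w3].
    by apply: (n12 [:: w]); rewrite // link_cons link_nil f1w.
  by apply: (n13 [:: w]); rewrite // link_cons link_nil f1w.
(* A crossing from [p] to [f2] that is not a chord has [f2] and [f4] on one side. *)
have np2 S : link p S f2 -> ~~ nilp S -> uniq (S ++ Q) -> False.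
  move=> LS nS U.
  have := @theta_cross G asp b p f2 [:: f1] [:: f3; f4] S f1 [::] f2 [:: f3] f4 [::].
  rewrite !link_cons !link_nil LS p1 e12 e23 e34 (adj_sym f4) p4 b1 b2 b4 mem_head (negbTE nS).
  have -> : uniq [:: b, p, f2 & [:: f1] ++ [:: f3; f4] ++ S] by ucount U.
  by move=> /(_ isT isT isT isT isT isT erefl isT isT).
have pair w1 w2 : (forall S, link w1 S w2 -> ~~ nilp S -> uniq (S ++ Q) -> False) ->
    att w1 -> att w2 -> False.
  by move=> h a1 a2; have [S [LS nS U]] := join _ _ a1 a2; exact: h LS nS U.
have a12 := pair _ _ n12. have a13 := pair _ _ n13. have a14 := pair _ _ n14.
have a23 := pair _ _ n23. have a34 := pair _ _ n34. have ap2 := pair _ _ np2.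
have nb f : b -- f -> f != b by apply: contraTneq => ->; rewrite adj_irrefl.
have pQ : p \in Q by rewrite !inE eqxx orbT.
have pb : p != b by apply: contraTneq UQ => ->; rewrite cons_uniq mem_head.
have fQ f : f \in [:: f1; f2; f3; f4] -> f \in Q by move=> h; rewrite 2!in_cons h !orbT.
have Qf w : w \in Q -> w != b -> w != p -> w \in [:: f1; f2; f3; f4].
  by rewrite 2!in_cons => /or3P[->|->|].
(* A third attachment of [v] leads back to one of the previous cases. *)
have a24 : att f2 -> att f4 -> False.
  move=> a2 a4; have [||||w [aw wQ wb /andP[w2 w4]]] := reach f2 f4; rewrite ?nb //;
    try by apply: fQ; rewrite !inE eqxx ?orbT.
  have [wp|wp] := eqVneq w p; first by subst w; exact: ap2.
  have := Qf _ wQ wb wp; rewrite !inE (negbTE w2) (negbTE w4) orbF /=.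
  by case/orP=> /eqP E; subst w; auto.
have [||||q1 [aq1 q1Q q1b /andP[q1p _]]] := reach p p; rewrite ?pb //.
have [||||q2 [aq2 q2Q q2b /andP[q2p q21]]] := reach p q1; rewrite ?pb //.
move: q21; have := Qf _ q1Q q1b q1p; have := Qf _ q2Q q2b q2p; rewrite !inE.
by case/or4P=> /eqP E2; case/or4P=> /eqP E1; subst q1 q2; rewrite ?eqxx //; auto.
Qed.

(** A vertex of the circuit not adjacent to [b] lies on an arc between two neighbours whose
    complement carries all neighbours. *)
Lemma circuit_within_nbrs c : circuit_off b c -> (forall u, b -- u -> u \in c) ->
  forall u, u \in c -> b -- u.
Proof.
move=> [cc Ubc c2] cN u uc; apply/negPn/negP => nbu.
have [i l E] := rot_to uc.
have Ul : uniq (b :: u :: l).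
  by rewrite -E cons_uniq mem_rot rot_uniq -cons_uniq.
have Ll : link u l u by move: cc; rewrite -(rot_cycle i) E.
have lN v : b -- v -> v \in l.
  move=> bv; have := cN _ bv; rewrite -(mem_rot i) E inE => /predU1P[vu|//].
  by rewrite -vu bv in nbu.
have cl := count_nbrs d4 lN.
have /has_split[L1 [t [L' [El bt nL1]]]] : has (adj b) l by rewrite has_count; move: cl; clear;
  lia.
have /has_split[L2r [s [Mr [EL bs nL2]]]] : has (adj b) (rev L').
  by move: cl nL1; rewrite El count_cat /= bt has_rev !has_count; clear; lia.
have {}EL : L' = rev Mr ++ s :: rev L2r by rewrite -[L']revK EL rev_cat rev_cons cat_rcons.
subst L' l; move: Ll; rewrite !link_cat => /and3P[L1' LM L2'].
have LA : link t (rev L1 ++ u :: L2r) s by rewrite link_cat link_rev L1' -link_rev.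
have nA : ~~ nilp (rev L1 ++ u :: L2r) by case: (rev L1).
have U : uniq (b :: t :: s :: rev Mr ++ (rev L1 ++ u :: L2r)) by ucount Ul.
have NF v : b -- v -> v \in t :: s :: rev Mr.
  move=> bv; have := lN v bv; rewrite !(mem_cat, inE, mem_rev).
  have /negbTE-> : v \notin L1 by apply: contra nL1 => h; apply/hasP; exists v.
  have /negbTE-> : v \notin L2r by apply: contra nL2 => h; apply/hasP; exists v.
  by rewrite orbF /= => /or3P[->|->|->]; rewrite ?orbT.
have [x [y [EM bx by_ [p [pA pt ps pxy]]]]] := arc_forces_tripod G3 asp d4 LM LA nA U bt bs NF.
move: LM U NF; rewrite EM => LM U NF.
have Up : uniq [:: b; p; t; x; y; s].
  case/splitPr: pA U => A1 A2 U; by ucount U.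
move: LM; rewrite !link_cons link_nil => /and3P[tx xy ys].
case: pxy => [px|py].
  apply: (four_rim_small Up) => // v /NF; rewrite !inE; by do 4!case: eqP.
have Up' : uniq [:: b; p; s; y; x; t] by ucount Up.
apply: (four_rim_small Up'); rewrite // 1?adj_sym // => v /NF; rewrite !inE; by do 4!case: eqP.
Qed.

End Hub.

(** * Vertices of degree at least four: the wheel *)

Section Wheel.
Variable G : sgraph.
Hypotheses (G3 : k_connected 3 G) (asp : ASP G) (G7 : 6 < #|G|).
Variables (b : G) (c : seq G).
Hypotheses (d4 : 4 <= degree b) (Cc : circuit_off b c).
Hypothesis cN : forall u, (b -- u) = (u \in c).

(** A nonempty link inserted between consecutive vertices gives a circuit through all
    neighbours and through other vertices. *)
Lemma no_insertion p S q B : perm_eq c (p :: q :: B) -> link p S q -> link q B p ->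
  uniq (b :: p :: q :: S ++ B) -> nilp S.
Proof.
move=> cE LS LB U; case: S LS U => // v S LS U; exfalso.
have Cc' : circuit_off b (p :: (v :: S) ++ q :: B).
  split; last by rewrite /= size_cat /= addnS.
    by rewrite -[cycle _ _]/(link p ((v :: S) ++ q :: B) p) link_cat LS.
  by ucount U.
have cN' u : b -- u -> u \in p :: (v :: S) ++ q :: B.
  by rewrite cN (perm_mem cE) !(inE, mem_cat); case/or3P=> ->; rewrite ?orbT.
have := circuit_within_nbrs G3 asp G7 d4 Cc' cN' (u := v).
rewrite cN (perm_mem cE) !inE eqxx orbT => /(_ isT) vE.
have : uniq (v :: p :: q :: B) by ucount U.
by rewrite cons_uniq !inE vE.
Qed.

(** All vertices of the circuit are neighbours of [b], so [theta_cross] bounds the length of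
    each side of a crossing, more severely if the crossing is not a chord. *)
Lemma theta_side p q A B R s z : link p A q -> link q B p -> link p R q ->
    uniq (b :: p :: q :: A ++ B ++ R) -> s \in A -> z \in B -> {subset p :: q :: A ++ B <= c} ->
  size B <= 2 /\ (~~ nilp R -> B = [:: z]).
Proof.
move=> LA LB LR U sA zB sub.
have bs : b -- s by rewrite cN sub // !inE mem_cat sA !orbT.
have bq : b -- q by rewrite cN sub // !inE eqxx orbT.
have bB w : w \in B -> b -- w by move=> wB; rewrite cN sub // !inE mem_cat wB !orbT.
have cross := theta_cross asp LA LB LR U sA bs.
split.
  case: B cross bB {LB U zB sub} => [|b1 [|b2 [|b3 B]]] // cross bB.
  have := cross [:: q] b1 [:: b2] b3 B (erefl _).
  by rewrite !bB ?inE ?eqxx ?orbT // => /(_ isT isT).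
move=> nR; case/lastP: B zB cross bB {LB U sub} => // B w zB cross bB.
have := cross [::] q B w [::]; rewrite cats1 bq bB ?mem_last_rcons // => /(_ erefl isT isT).
rewrite (negbTE nR) /= orbF => /nilP E; move: zB; rewrite E inE => /eqP->.
by [].
Qed.

(** A vertex off the circuit has three attachments. By [no_insertion] no two are
    consecutive, so two of them are the ends of a crossing with vertices on both sides;
    [theta_side] leaves one vertex on each side, and the third attachment is consecutive to
    an end. *)
Lemma rim_spans v : v \in b :: c.
Proof.
apply/negPn/negP => vbc; have [vb vc] : v != b /\ v \notin c by apply/andP;
  rewrite -negb_or -in_cons.
have [p [q [s0 [t0 [[pc qc pq L1 L2] U]]]]] := circuit_fan G3 Cc vb vc.
have [cc Ubc c2] := Cc.
have Uc : uniq c by move: Ubc; rewrite cons_uniq => /andP[].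
have [A [B [LA LB _ cE]]] := cycle_split cc Uc pc qc pq.
pose R := rev s0 ++ v :: t0.
have LR : link p R q by rewrite link_cat link_rev L1.
have nR : ~~ nilp R by rewrite /R; case: (rev s0).
have Ur : uniq (b :: p :: q :: A ++ B ++ R).
  have : uniq ((v :: s0 ++ t0) ++ b :: p :: A ++ q :: B).
    by rewrite -(perm_uniq (s1 := (v :: s0 ++ t0) ++ b :: c)) // perm_cat2l perm_cons.
  by rewrite /R => U'; ucount U'.
case: A LA cE Ur => [|a A] LA cE Ur.
  have : nilp R by apply: (no_insertion cE LR LB); ucount Ur.
  by rewrite (negbTE nR).
case: B LB cE Ur => [|z B] LB cE Ur.
  have cE' : perm_eq c (q :: p :: a :: A).
    by apply: perm_trans cE _; apply/permP => x; rewrite /= count_cat /=; clear; lia.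
  have LR' : link q (rev R) p by rewrite link_rev.
  have : nilp (rev R) by apply: (no_insertion cE' LR' LA); ucount Ur.
  by rewrite /nilp size_rev -/(nilp R) (negbTE nR).
have sub : {subset p :: q :: (a :: A) ++ z :: B <= c}.
  by move=> x; rewrite (perm_mem cE) !(inE, mem_cat) => /or4P[->|->|->|/or3P[]->];
    rewrite ?orbT.
have [_ /(_ nR) EB] := theta_side LA LB LR Ur (mem_head a A) (mem_head z B) sub.
have LA' : link q (rev (a :: A)) p by rewrite link_rev.
have LB' : link p (rev (z :: B)) q by rewrite link_rev.
have Ur' : uniq (b :: p :: q :: rev (z :: B) ++ rev (a :: A) ++ R) by ucount Ur.
have zr : z \in rev (z :: B) by rewrite mem_rev mem_head.
have ar : a \in rev (a :: A) by rewrite mem_rev mem_head.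
have sub' : {subset p :: q :: rev (z :: B) ++ rev (a :: A) <= c}.
  move=> x xE; apply: sub; move: xE; rewrite !(inE, mem_cat, mem_rev).
  by case/or3P=> [->|->|/orP[/orP[->|->]|/orP[->|->]]]; rewrite ?orbT.
have [_ /(_ nR) EA] := theta_side LB' LA' LR Ur' zr ar sub'.
have {}EA : A = [::] by move: EA => /(congr1 size); rewrite size_rev /= => -[/size0nil].
case: EB => EB; subst A B; rewrite !link_cons !link_nil in LA LB.
have [pa aq] := andP LA; have [qz zp] := andP LB.
pose O := ~: [set x | x \in b :: c].
have vO : v \in O by rewrite !inE.
have s0O : {subset s0 <= O}.
  move=> x xs; rewrite in_setC inE; apply: contraTN U => xbc.
  by rewrite cat_uniq; apply/negP => /and3P[_ /hasPn/(_ _ xbc)]; rewrite /= inE mem_cat xs orbT.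
pose T := [pred x | x \in b :: c].
have dST x : pred1 v x -> ~~ T x by move=> /eqP->.
have bnc : b \notin c by rewrite -cN adj_irrefl.
have nbc x : x \in c -> b != x by move=> xc; apply: contraNneq bnc => ->.
have nvc x : x \in c -> v != x by move=> xc; apply: contraNneq vc => ->.
have [|||v' [R' [w [/eqP-> wT LR' UR' [_ wA RP]]]]] :=
  @bridge3 G [set p; q] (pred1 v) T v b G3 _ (eqxx _) (mem_head _ _) _ _ dST.
- by rewrite cards2; case: (_ != _).
- by rewrite !inE negb_or !nvc.
- by rewrite !inE negb_or !nbc.
have RO : {subset R' <= O} by move=> x /RP /and3P[_ h _]; rewrite in_setC inE.
have [S [LS SO nS US]] := link_join vO L1 LR' s0O RO.
have USc : uniq (S ++ b :: c).
  apply: (uniq_cat_disj (P := mem O)) => // x xbc; by rewrite /= in_setC inE negbK.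
have {}USc : uniq (S ++ b :: [:: p; a; q; z]).
  by rewrite -(perm_uniq (s1 := S ++ b :: c)) // perm_cat2l perm_cons.
move: wT; rewrite /T /= inE => /predU1P[wb|].
  subst w; have [x xR xb] := link_last LR'.
  have : x \in O by move: xR; rewrite inE => /predU1P[->|/RO].
  by rewrite in_setC !inE -cN adj_sym xb orbT.
move: wA; rewrite (perm_mem cE) !inE negb_or /= => /andP[/negbTE-> /negbTE->] /= /orP[]/eqP E;
  subst w.
  have : nilp S; last by rewrite (negbTE nS).
  apply: (@no_insertion p S a [:: q; z]) => //; last by ucount USc.
  by rewrite !link_cons link_nil aq qz.
have : nilp S; last by rewrite (negbTE nS).
apply: (@no_insertion p S z [:: q; a]) => //; last by ucount USc.
  by apply: perm_trans cE _; apply/permP => x /=; clear; lia.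
by rewrite !link_cons link_nil adj_sym qz adj_sym aq adj_sym pa.
Qed.

Lemma rim_size : size c = #|G|.-1.
Proof.
have [_ Ubc _] := Cc.
have -> : #|G| = size (b :: c) by rewrite -(card_uniqP Ubc); apply: eq_card => x;
  rewrite rim_spans.
by [].
Qed.

(** By [theta_side] a chord leaves at most two vertices on each side, hence exactly two
    because there are at least seven vertices, and [theta_two_two] excludes that. *)
Lemma rim_chord C1 p M q C2 : c = C1 ++ p :: M ++ q :: C2 -> p -- q ->
  nilp M || nilp (C2 ++ C1).
Proof.
move=> E pq; have [cc Ubc _] := Cc.
have : cycle (@adj G) (p :: M ++ q :: C2 ++ C1).
  by move: cc; rewrite E -(rot_cycle (size C1)) rot_size_cat /= -catA.
rewrite -[cycle _ _]/(link p (M ++ q :: C2 ++ C1) p) link_cat => /andP[LM LC].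
have LR : link p [::] q by rewrite link_nil.
move: Ubc; rewrite E => U.
have sz : 6 <= size M + size (C2 ++ C1) + 2.
  have := rim_size; rewrite E !size_cat /= size_cat /=; case: #|G| G7 => //= n; clear; lia.
set B := C2 ++ C1 in LC sz *.
have UB : uniq (b :: p :: q :: M ++ B ++ [::]) by rewrite /B; ucount U.
have sub : {subset p :: q :: M ++ B <= c}.
  by move=> x; rewrite E /B !(inE, mem_cat); case/or4P=> [->|->|->|/orP[->|->]]; rewrite ?orbT.
clearbody B; clear U E.
case: M LM UB sub sz => [//|s M] LM UB sub sz; case: B LC UB sub sz => [|t B] LC UB sub sz;
  first by rewrite orbT.
have [szB _] := theta_side LM LC LR UB (mem_head s M) (mem_head t B) sub.
have LM' : link q (rev (s :: M)) p by rewrite link_rev.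
have LC' : link p (rev (t :: B)) q by rewrite link_rev.
have UB' : uniq (b :: p :: q :: rev (t :: B) ++ rev (s :: M) ++ [::]) by ucount UB.
have tr : t \in rev (t :: B) by rewrite mem_rev mem_head.
have sr : s \in rev (s :: M) by rewrite mem_rev mem_head.
have sub' : {subset p :: q :: rev (t :: B) ++ rev (s :: M) <= c}.
  move=> x xE; apply: sub; move: xE; rewrite !(inE, mem_cat, mem_rev).
  by case/or3P=> [->|->|/orP[/orP[->|->]|/orP[->|->]]]; rewrite ?orbT.
have [szM _] := theta_side LC' LM' LR UB' tr sr sub'.
case: M LM LM' UB UB' sub sub' sr szM sz => [|s2 [|s3 M]] LM LM' UB UB' sub sub' sr szM sz.
- by move: szB sz; rewrite /=; clear; lia.
- case: B LC LC' UB UB' sub sub' tr szB sz => [|t2 [|t3 B]] LC LC' UB UB' sub sub' tr szB sz //.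
  have bc x : x \in c -> b -- x by rewrite cN.
  apply: (@theta_two_two G asp b p q s [:: s2] [::] t [::] t2 [::] [::]) => //.
  + by apply: bc; apply: sub; rewrite !inE eqxx !orbT.
  + by apply: bc; apply: sub; rewrite !inE eqxx !orbT.
  + by apply: bc; apply: sub; rewrite !inE eqxx !orbT.
- by move: szM; rewrite size_rev.
Qed.

Lemma rim_nth_adj i j : i < j < size c ->
  (nth b c i -- nth b c j) = (j == i.+1) || ((i == 0) && (j == (size c).-1)).
Proof.
case/andP=> ij jr; have ir := ltn_trans ij jr; have [cc _ _] := Cc.
have E : c = take i c ++ nth b c i :: take (j - i.+1) (drop i.+1 c) ++ nth b c j :: drop j.+1 c.
  have Ej : drop j c = drop (j - i.+1) (drop i.+1 c) by rewrite drop_drop subnK.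
  by rewrite -(drop_nth b jr) Ej cat_take_drop -(drop_nth b ir) cat_take_drop.
have wrap k : k < size c -> nth b c k -- nth b c (if k.+1 == size c then 0 else k.+1).
  move: cc; case: (c) => //= x s /(pathP b) P kr; have := P k; rewrite size_rcons => /(_ kr).
  rewrite nth_rcons eqSS -rcons_cons nth_rcons /= kr.
  case: (ltngtP k (size s)) => [lt|gt|->] //=.
  by move: kr; rewrite ltnS leqNgt gt.
apply/idP/orP => [adj_ij|[/eqP->|/andP[/eqP-> /eqP->]]].
- case/orP: (rim_chord E adj_ij) => /nilP.
    move/(congr1 size); rewrite size_take size_drop /=; case: ifP => _ h; left; apply/eqP;
      move: h ij jr; clear; lia.
  move/(congr1 size); rewrite size_cat size_drop size_take ir /= => h.
  by right; move: h jr; clear; lia.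
- by have := wrap i ir; rewrite ifN // neq_ltn (leq_ltn_trans ij jr).
- have r0 : 0 < size c by exact: leq_ltn_trans (leq0n _) jr.
  have := wrap (size c).-1; rewrite prednK // leqnn eqxx => /(_ isT).
  by rewrite adj_sym.
Qed.

Lemma hub_rim_wheel : isomorphic G (wheel (size c)).
Proof.
have [cc Ubc _] := Cc; have Uc : uniq c by move: Ubc; rewrite cons_uniq => /andP[].
pose h (x : option 'I_(size c)) : G := if x is Some i then nth b c i else b.
have h_inj : injective h.
  have bnc : b \notin c by move: Ubc; rewrite cons_uniq => /andP[].
  move=> [i|] [j|] //= E; first by congr Some; apply: val_inj;
    have := nth_uniq b (ltn_ord i) (ltn_ord j) Uc; rewrite E eqxx => /esym/eqP.
    by move: bnc; rewrite -E mem_nth.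
  by move: bnc; rewrite E mem_nth.
have [|g hK gK] := inj_card_bij h_inj.
  by rewrite card_option card_ord rim_size prednK // (ltn_trans _ G7).
exists g; first by exists h.
have rP : 6 <= size c by rewrite rim_size -ltnS prednK // (ltn_trans _ G7).
have hP x y : h x -- h y = wheel_adj x y.
  case: x y => [i|] [j|] /=; last by rewrite adj_irrefl.
  - rewrite -val_eqE -[j == _]val_eqE -[i == ordS j]val_eqE /=.
    have lt_case (k l : nat) : k < l < size c ->
      (nth b c k -- nth b c l) = (k != l) && ((l == k.+1 %% size c) || (k == l.+1 %% size c)).
      move=> /andP[kl lr]; rewrite rim_nth_adj ?kl ?lr // (ltn_eqF kl) /=.
      rewrite [k.+1 %% _]modn_small; last exact: leq_ltn_trans kl lr.
      case: (ltngtP l.+1 (size c)) => [lt||E].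
      + by rewrite modn_small //; move: kl lt; clear; lia.
      + by rewrite ltnS leqNgt lr.
      + by rewrite -E modnn; congr (_ || _); rewrite /= eqxx andbT.
    have [kl|kl|/val_inj->] := ltngtP (val i) (val j).
    + by rewrite lt_case ?kl ?ltn_ord // (ltn_eqF kl).
    + by rewrite adj_sym lt_case ?kl ?ltn_ord // (ltn_eqF kl) orbC.
    + by rewrite adj_irrefl.
  - by rewrite adj_sym cN mem_nth.
  - by rewrite cN mem_nth.
by move=> x y; rewrite -{2}(gK x) -{2}(gK y) hP.
Qed.

End Wheel.

Lemma hub_wheel G : k_connected 3 G -> ASP G -> 6 < #|G| -> forall b : G, 4 <= degree b ->
  K3r_type G \/ exists r, 6 <= r /\ isomorphic G (wheel r).
Proof.
move=> G3 asp G7 b d4; have [|[c Cc cN]] := circuit_thru_nbrs G3 asp G7 b; first by left.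
have cNE u : (b -- u) = (u \in c).
  by apply/idP/idP; [exact: cN | exact: (circuit_within_nbrs G3 asp G7 d4 Cc cN)].
right; exists (size c); split; last exact: hub_rim_wheel Cc cNE.
by rewrite (rim_size G3 asp G7 d4 Cc cNE) -ltnS prednK // (ltn_trans _ G7).
Qed.

(** * Cubic graphs and the classification *)

Lemma nbrs3 (G : sgraph) (b u v w : G) : degree b = 3 -> uniq [:: u; v; w] ->
  b -- u -> b -- v -> b -- w -> forall x, (b -- x) = (x \in [:: u; v; w]).
Proof.
move=> d3 U bu bv bw x.
have /subset_leqif_cards sub : [set z | z \in [:: u; v; w]] \subset [set y | b -- y].
  by apply/subsetP => z; rewrite !inE => /or3P[]/eqP->.
have E : #|[set z | z \in [:: u; v; w]]| = 3 by rewrite cardsE (card_uniqP U).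
have /eqP/setP/(_ x) : [set z | z \in [:: u; v; w]] == [set y | b -- y].
  by rewrite -sub E; apply/eqP; rewrite -d3.
by rewrite !in_set => <-.
Qed.

Lemma triangleP (G : sgraph) (T : {set G}) (b : G) : triangle T -> b \in T ->
  exists u v, [/\ T = [set b; u; v], b -- u, b -- v & u -- v].
Proof.
move=> /andP[/eqP /set3_list[x [y [z [U TE]]]] /forallP adjT] bT.
have adjE u v : u \in T -> v \in T -> u != v -> u -- v.
  by move=> uT vT uv; have /implyP/(_ uT)/forallP/(_ v)/implyP/(_ vT)/implyP/(_ uv) := adjT u.
have [u [v [Ub TE']]] : exists u v, uniq [:: b; u; v] /\ T =i [:: b; u; v].
  move: bT; rewrite TE !inE => /or3P[]/eqP->; [exists y, z | exists x, z | exists x, y].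
  - by [].
  - by split; [ucount U | move=> w; rewrite TE !inE; do 3!case: eqP].
  - by split; [ucount U | move=> w; rewrite TE !inE; do 3!case: eqP].
move: Ub; rewrite !cons_uniq !inE negb_or => /and3P[/andP[bu bv] uv _].
exists u, v; split; try by apply: adjE; rewrite ?TE' ?inE ?eqxx ?orbT.
by apply/setP => w; rewrite TE' !inE orbA.
Qed.

Lemma triangle3 (G : sgraph) (b u v : G) : b -- u -> b -- v -> u -- v -> triangle [set b; u; v].
Proof.
move=> bu bv uv; have irr x y : x -- y -> x != y by apply: contraTneq => ->; rewrite adj_irrefl.
apply/andP; split.
  have -> : [set b; u; v] = [set x | x \in [:: b; u; v]] by apply/setP => x; rewrite !inE orbA.
  apply/eqP; rewrite cardsE; apply: card_uniqP.
  by rewrite !cons_uniq !inE negb_or !irr.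
apply/forallP => x; apply/implyP; rewrite !inE => xT; apply/forallP => y; apply/implyP;
  rewrite !inE => yT.
apply/implyP; case/orP: xT => [/orP[]|] /eqP->; case/orP: yT => [/orP[]|] /eqP-> //;
  rewrite ?eqxx // => _; by rewrite adj_sym.
Qed.

Section Cubic.
Variable G : sgraph.
Hypotheses (G3 : k_connected 3 G) (G5 : 4 < #|G|).

(** The vertices [v] and [w] would separate [b] and [u] from the rest. *)
Lemma no_cubic_diamond (b u v w : G) : degree b = 3 -> degree u = 3 -> v != w ->
  b -- u -> b -- v -> b -- w -> u -- v -> u -- w -> False.
Proof.
move=> db du vw bu bv bw uv uw.
have irr x y : x -- y -> x != y by apply: contraTneq => ->; rewrite adj_irrefl.
have Nb := nbrs3 db (_ : uniq [:: u; v; w]) bu bv bw.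
have Nu := nbrs3 du (_ : uniq [:: b; v; w]) (_ : u -- b) uv uw.
have {}Nb := Nb ltac:(by rewrite !cons_uniq !inE negb_or vw !irr).
have {}Nu := Nu ltac:(by rewrite !cons_uniq !inE negb_or vw !irr) ltac:(by rewrite adj_sym).
pose S := [pred x | x \in [:: b; u]]; pose T := [pred x | x \notin [:: b; u; v; w]].
have [z zT] : exists z, T z.
  apply/existsP; rewrite -negb_forall; apply/negP => /forallP h.
  have : #|G| <= size [:: b; u; v; w].
    by apply: leq_trans (card_size _); apply: subset_leq_card; apply/subsetP => x _; apply: h.
  by move=> /(leq_trans G5).
have [|||||p [r [q [Sp Tq Lr _ [_ _ rP]]]]] := @bridge3 G [set v; w] S T b z G3 _ _ zT.
- by rewrite cards2; case: (_ != _).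
- by rewrite /S /= mem_head.
- by rewrite !inE negb_or !irr.
- by move: zT; rewrite /T /= !inE !negb_or => /and4P[_ _ -> ->].
- by move=> x; rewrite /S /T /= !inE => /orP[]->; rewrite ?orbT.
have r0 : r = [::].
  case: r rP {Lr} => // x r /(_ x (mem_head _ _)) /and3P[].
  by rewrite /S /T /= negbK !inE negb_or => /andP[/negbTE-> /negbTE->] /= ->.
move: Lr Tq; rewrite r0 link_nil /T /= => pq; apply/negP; rewrite negbK.
move: Sp; rewrite /S /= !inE => /orP[]/eqP E; subst p.
  by move: pq; rewrite Nb !inE => ->; rewrite orbT.
by move: pq; rewrite Nu !inE => /orP[]->; rewrite ?orbT.
Qed.

(** Two different triangles at a vertex of degree three share an edge. *)
Lemma cubic_truncated : cubic G ->
    (forall b : G, exists u v, [/\ b -- u, b -- v & u -- v]) -> truncated_cubic G.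
Proof.
move=> cub tri; split=> // b; have [u [v [bu bv uv]]] := tri b.
have T0 := triangle3 bu bv uv.
apply/eqP/cards1P; exists [set b; u; v]; apply/setP => T; rewrite in_set in_set1.
apply/andP/eqP => [[tT bT]|->]; last by rewrite T0 !inE eqxx.
have [u' [v' [-> bu' bv' uv']]] := triangleP tT bT.
have irr x y : x -- y -> x != y by apply: contraTneq => ->; rewrite adj_irrefl.
have key w w' : b -- w -> b -- w' -> w -- w' -> w \notin [:: u; v] -> False.
  move=> bw bw' ww' wuv; have Uuvw : uniq [:: u; v; w].
    by move: wuv; rewrite !cons_uniq !inE !negb_or !(eq_sym w) => /andP[-> ->]; rewrite irr.
  move: bw'; rewrite (nbrs3 (cub b) Uuvw) // !inE => /or3P[]/eqP E; subst w'.
  - apply: (@no_cubic_diamond b u v w) => //; last by rewrite adj_sym.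
    by move: Uuvw; rewrite !cons_uniq !inE => /and3P[_ ->].
  - apply: (@no_cubic_diamond b v u w) => //; rewrite 1?adj_sym //.
    by move: Uuvw; rewrite cons_uniq !inE negb_or => /andP[/andP[]].
  - by rewrite adj_irrefl in ww'.
have u'P : u' \in [:: u; v] by apply/negPn/negP => /(key u' v' bu' bv' uv').
have v'P : v' \in [:: u; v] by apply/negPn/negP => /(key v' u' bv' bu'); rewrite adj_sym; apply.
have := irr _ _ _ uv'.
move: u'P v'P; rewrite !inE => /orP[]/eqP-> /orP[]/eqP->; rewrite ?eqxx // => _.
by apply/setP => x; rewrite !inE orbAC.
Qed.

End Cubic.

Lemma asp_classification G : k_connected 3 G -> ASP G ->
  [\/ #|G| <= 6, K3r_type G, exists r : nat,
    6 <= r /\ isomorphic G (wheel r) | truncated_cubic G].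
Proof.
move=> G3 asp; case: (leqP #|G| 6) => [|G7]; first by constructor 1.
case: (boolP [exists b : G, 4 <= degree b]) => [/existsP[b d4]|].
  by have [h|h] := hub_wheel G3 asp G7 d4; [constructor 2 | constructor 3].
rewrite negb_exists => /forallP d4.
have cub : cubic G by move=> b; apply/eqP; rewrite eqn_leq min_degree // leqNgt d4.
case: (boolP [forall b : G, [exists u, exists v, [&& b -- u, b -- v & u -- v]]]) =>
  [/forallP tri|].
  constructor 4; apply: cubic_truncated => //; first exact: ltn_trans G7.
  by move=> b; have /existsP[u /existsP[v /and3P[bu bv uv]]] := tri b; exists u, v.
rewrite negb_forall => /existsP[b nb]; constructor 2.
apply: (degree3_independent G3 asp G7 (cub b)) => u v bu bv.
by apply: contra nb => uv; apply/existsP; exists u; apply/existsP; exists v; rewrite bu bv.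
Qed.

(** * The four classes are almost series-parallel *)

Definition nbr (G : sgraph) (x : G) := [set y | x -- y].

Lemma degree_inj (H G : sgraph) (f : H -> G) x : injective f -> (forall x y, x -- y ->
  f x -- f y) ->
  f @: nbr x \subset nbr (f x) /\ #|f @: nbr x| = degree x.
Proof.
move=> f_inj fM; split; last by rewrite card_imset.
by apply/subsetP => z /imsetP[y]; rewrite !inE => xy ->; exact: fM.
Qed.

Lemma skel_sym (H : sgraph) (x y : H) : skel_edge x y -> skel_edge y x.
Proof. by rewrite /skel_edge /= adj_sym => /and3P[-> -> ->]. Qed.

Section PathSkeleton.
Variables (H : sgraph) (k : nat).
Hypotheses (k4 : k <= 4) (iso : isomorphic (skeleton H) (pathg k)).

(** Vertices of the skeleton are numbered by their positions on the path, so that the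
    restrictions on the skeleton become statements about consecutive integers. *)
Lemma skel_position : exists phi : H -> nat,
  forall x y, skel_edge x y -> [/\ (phi x).+1 = phi y \/ (phi y).+1 = phi x, phi x < 4 &
    forall x' y', skel_edge x' y' -> phi x = phi x' -> x = x'].
Proof.
have [f /bij_inj f_inj fM] := iso.
pose phi (x : H) : nat := if insub x is Some s then f s else 0.
have phiE x y (xy : skel_edge x y) : exists s : skel_vertex H, val s = x /\ phi x = f s.
  have xP : [exists y, skel_edge x y] by apply/existsP; exists y.
  by exists (Sub x xP); split; rewrite ?SubK // /phi insubT.
exists phi => x y xy.
have yx := skel_sym xy.
have [s [sx px]] := phiE _ _ xy; have [t [ty py]] := phiE _ _ yx.
split.
- have := fM s t; rewrite /= /skel_adj /= /pathg_adj /= sx ty xy px py => /orP[]/eqP; auto.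
- by rewrite px; apply: leq_trans (ltn_ord _) k4.
- move=> x' y' /phiE[s' [sx' px']]; rewrite px px' => /val_inj/f_inj E.
  by rewrite -sx -sx' E.
Qed.

Lemma skel_degree2 x (y1 y2 y3 : H) : uniq [:: y1; y2; y3] ->
  skel_edge x y1 -> skel_edge x y2 -> skel_edge x y3 -> False.
Proof.
have [phi P] := skel_position => U e1 e2 e3.
have [a1 _ _] := P _ _ e1; have [a2 _ _] := P _ _ e2; have [a3 _ _] := P _ _ e3.
have [_ _ i1] := P _ _ (skel_sym e1); have [_ _ i2] := P _ _ (skel_sym e2).
have n12 : phi y1 <> phi y2.
  by move=> /(i1 _ _ (skel_sym e2)) E; move: U; rewrite E cons_uniq mem_head.
have n13 : phi y1 <> phi y3.
  by move=> /(i1 _ _ (skel_sym e3)) E; move: U; rewrite E cons_uniq !inE eqxx orbT.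
have n23 : phi y2 <> phi y3.
  by move=> /(i2 _ _ (skel_sym e3)) E; move: U; rewrite E !cons_uniq mem_head andbF.
by move: a1 a2 a3 n12 n13 n23; clear; lia.
Qed.

Lemma skel_no_square x y (a c : H) : x != y -> a != c ->
  skel_edge x a -> skel_edge x c -> skel_edge y a -> skel_edge y c -> False.
Proof.
have [phi P] := skel_position => xy ac xa xc ya yc.
have [a1 _ ix] := P _ _ xa; have [a2 _ _] := P _ _ xc; have [a3 _ _] := P _ _ ya;
  have [a4 _ _] := P _ _ yc.
have [_ _ ia] := P _ _ (skel_sym xa).
have nxy : phi x <> phi y by move=> /(ix _ _ ya) E; rewrite E eqxx in xy.
have nac : phi a <> phi c by move=> /(ia _ _ (skel_sym xc)) E; rewrite E eqxx in ac.
by move: a1 a2 a3 a4 nxy nac; clear; lia.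
Qed.

Lemma skel_no_triangle (x y z : H) : skel_edge x y -> skel_edge y z -> skel_edge z x -> False.
Proof.
have [phi P] := skel_position => xy yz zx.
have [a1 _ _] := P _ _ xy; have [a2 _ _] := P _ _ yz; have [a3 _ _] := P _ _ zx.
by move: a1 a2 a3; clear; lia.
Qed.

(** A path on at most four vertices has at most two inner vertices. *)
Lemma skel_two_inner (x1 x2 x3 : H) : uniq [:: x1; x2; x3] ->
  {in [:: x1; x2; x3], forall x, exists a c, [/\ a != c, skel_edge x a & skel_edge x c]} ->
    False.
Proof.
have [phi P] := skel_position => U two.
have rng x : x \in [:: x1; x2; x3] -> 0 < phi x < 3 /\ exists a, skel_edge x a.
  move=> /two [a [c [ac xa xc]]].
  have [a1 _ _] := P _ _ xa; have [a2 _ _] := P _ _ xc.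
  have [_ a4 ia] := P _ _ (skel_sym xa); have [_ c4 _] := P _ _ (skel_sym xc).
  have nac : phi a <> phi c by move=> /(ia _ _ (skel_sym xc)) E; rewrite E eqxx in ac.
  by split; [move: a1 a2 a4 c4 nac; clear; lia | exists a].
have [r1 [a1 e1]] := rng x1 ltac:(by rewrite !inE eqxx).
have [r2 [a2 e2]] := rng x2 ltac:(by rewrite !inE eqxx orbT).
have [r3 [a3 e3]] := rng x3 ltac:(by rewrite !inE eqxx !orbT).
have [_ _ i1] := P _ _ e1; have [_ _ i2] := P _ _ e2.
have n12 : phi x1 <> phi x2.
  by move=> /(i1 _ _ e2) E; move: U; rewrite E cons_uniq mem_head.
have n13 : phi x1 <> phi x3.
  by move=> /(i1 _ _ e3) E; move: U; rewrite E cons_uniq !inE eqxx orbT.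
have n23 : phi x2 <> phi x3.
  by move=> /(i2 _ _ e3) E; move: U; rewrite E !cons_uniq mem_head andbF.
by move: r1 r2 r3 n12 n13 n23; clear; lia.
Qed.

Lemma skel_inner : 3 <= k -> exists x a c : H, [/\ a != c, skel_edge x a & skel_edge x c].
Proof.
move=> k3; have [f [g fK gK] fM] := iso.
pose i0 : 'I_k := Ordinal (ltn_trans (isT : 0 < 2) k3).
pose i1 : 'I_k := Ordinal (ltn_trans (isT : 1 < 2) k3).
pose i2 : 'I_k := Ordinal k3.
have E (i j : 'I_k) : (i.+1 == j) || (j.+1 == i) -> skel_edge (val (g i)) (val (g j)).
  by have := fM (g i) (g j); rewrite !gK /= /pathg_adj /= /skel_adj /= => ->.
exists (val (g i1)), (val (g i0)), (val (g i2)); split; try exact: E.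
by rewrite (inj_eq val_inj) (inj_eq (can_inj gK)).
Qed.

End PathSkeleton.

(** With the shape of the skeleton, this is all that the converse needs to know of the
    subdivision: the branch vertices are those of degree at least three, and no other vertex
    joins two adjacent ones. *)
Lemma K4sub_structure k H : k <= 4 -> K4sub (pathg k) H ->
  exists B : {set H}, [/\ #|B| = 4, forall x, (x \in B) = (3 <= degree x) &
    forall x y z, x \in B -> y \in B -> x -- y -> z -- x -> z -- y -> z \notin B -> False].
Proof.
move=> k4 [[b [p [b_inj pP p_disj cover edges]]] _].
exists (b @: setT); split.
- by rewrite card_imset // cardsT card_ord.
- move=> x; apply/imsetP/idP => [[i _ ->]|].
    exact: (branch_degree b_inj pP p_disj).
  by move/(degree3_branch pP p_disj cover edges) => [i ->]; exists i.
- move=> x y z /imsetP[i _ ->] /imsetP[j _ ->] bij zi zj zB.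
  apply: (no_bypass b_inj pP p_disj cover edges bij zi zj) => l E.
  by move/negP: zB; apply; rewrite E imset_f.
Qed.

Section Forbidden.
Variables (k : nat) (H : sgraph).
Hypotheses (k3 : 3 <= k) (k4 : k <= 4) (KH : K4sub (pathg k) H).

(** If at most two vertices are not branch vertices, then the branch vertices with at most
    one branch neighbour, of which there are at least two, are adjacent to both; another
    branch vertex is adjacent to one of the two, which then has degree three. *)
Lemma K4sub_card : 7 <= #|H|.
Proof.
have [B [B4 BE _]] := K4sub_structure k4 KH; have [_ iso] := KH.
rewrite leqNgt; apply/negP => H6.
have N2 : #|~: B| <= 2 by have := cardsC B; rewrite B4; move: H6; clear; lia.
pose two (x : H) := [exists a, [exists c, [&& a != c, skel_edge x a & skel_edge x c]]].
have twoP x : two x -> exists a c, [/\ a != c, skel_edge x a & skel_edge x c].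
  by case/existsP=> a /existsP[c /and3P[ac xa xc]]; exists a, c.
have skB x y : x \in B -> y \in B -> x -- y -> skel_edge x y.
  by rewrite !BE /skel_edge /= => -> -> ->.
have Tw2 : #|[set x in B | two x]| <= 2.
  rewrite leqNgt; apply/negP => /card_gt2P[x [y [z [[xT yT zT] [xy yz zx]]]]].
  apply: (skel_two_inner k4 iso (x1 := x) (x2 := y) (x3 := z)).
    by rewrite !cons_uniq !inE negb_or xy yz eq_sym zx.
  by move=> w; rewrite !inE => /or3P[]/eqP->; apply: twoP; [move: xT|move: yT|move: zT];
    rewrite inE => /andP[].
have nTw2 : 1 < #|B :\: [set x in B | two x]|.
  have := cardsID [set x in B | two x] B; rewrite B4.
  have -> : B :&: [set x in B | two x] = [set x in B | two x] by apply/setP => x;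
    rewrite !inE andbA andbb.
  by move: Tw2; clear; lia.
have /card_gt1P[x [y [xT yT xy]]] := nTw2.
have full x0 : x0 \in B :\: [set x in B | two x] -> ~: B \subset nbr x0.
  rewrite in_setD in_set => /andP[ntw xB]; move: ntw; rewrite xB /= => ntw.
  have dx : 3 <= #|nbr x0| by move: xB; rewrite BE.
  have le1 : #|nbr x0 :&: B| <= 1.
    apply/card_le1_eqP => a c; rewrite !inE => /andP[xa aB] /andP[xc cB].
    apply/eqP; apply: contraNT ntw => ac; apply/existsP; exists a; apply/existsP; exists c.
    by rewrite eq_sym ac !skB.
  have ge2 : 2 <= #|nbr x0 :&: ~: B|.
    by have := cardsID B (nbr x0); rewrite setDE; move: dx le1; clear; lia.
  have /eqP <- : nbr x0 :&: ~: B == ~: B.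
    by rewrite eqEcard subsetIr (leq_trans N2).
  exact: subsetIl.
have [z zP] : exists z, z \in B :\: [set x; y].
  apply/set0Pn; rewrite -card_gt0; have := cardsID [set x; y] B; rewrite B4.
  have : #|B :&: [set x; y]| <= 2 by apply: leq_trans (subset_leq_card (subsetIr _ _)) _;
    rewrite cards2; case: (_ != _).
  by clear; lia.
move: zP; rewrite !inE negb_or => /andP[/andP[zx zy] zB].
have [w wN zw] : exists2 w, w \in ~: B & z -- w.
  have dz : 3 <= #|nbr z| by move: zB; rewrite BE.
  have /subsetPn[w] : ~~ (nbr z \subset B).
    apply/negP => sub; have /card_gt2P[a [c [d [[za zc zd] [ac cd da]]]]] := dz.
    have /(_ _ _)sk t : t \in nbr z -> skel_edge z t.
      by move=> tz; have tB := subsetP sub _ tz; apply: skB => //; move: tz; rewrite inE.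
    apply: (skel_degree2 k4 iso (x := z) (y1 := a) (y2 := c) (y3 := d)); auto.
    by rewrite !cons_uniq !inE negb_or ac cd eq_sym da.
  by rewrite inE => zw wB; exists w; rewrite ?inE.
have : 3 <= degree w.
  apply/card_gt2P; exists x, y, z; split; last by split; rewrite // eq_sym.
  by split; rewrite inE adj_sym //; [have := subsetP (full x xT) w wN|have := subsetP (full y
    yT) w wN]; rewrite inE.
by rewrite -BE; move: wN; rewrite inE => /negbTE->.
Qed.

(** The part of size three covers all edges, so a branch vertex off it is adjacent to all of
    it. If two branch vertices are off it, the two others lie on it and the skeleton has a
    square. *)
Lemma K4sub_not_D r : ~ subgraph H (D r).
Proof.
move=> [h h_inj hM]; have [B [B4 BE _]] := K4sub_structure k4 KH; have [_ iso] := KH.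
have skB x y : x \in B -> y \in B -> x -- y -> skel_edge x y.
  by rewrite !BE /skel_edge /= => -> -> ->.
pose X := [set x | if h x is inl _ then true else false].
have X3 : #|X| <= 3.
  pose g x : 'I_3 := if h x is inl i then i else ord0.
  rewrite -[leqRHS]card_ord -(card_in_imset (f := g) (D := mem X)); first exact: max_card.
  move=> x y; rewrite !inE /g => xX yX E; apply: h_inj; move: xX yX E.
  by case: (h x) (h y) => [i|i] // [j|j] // _ _ ->.
have cov x y : x -- y -> x \notin X -> y \in X.
  by move=> /hM; rewrite !inE; case: (h x) (h y) => [i|i] // [j|j].
have nX x : x \in B -> x \notin X -> nbr x = X /\ #|X| = 3.
  rewrite BE => dx xX; have sub : nbr x \subset X.
    by apply/subsetP => y; rewrite inE => xy; apply: cov xy xX.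
  have X3' : #|X| = 3 by apply/eqP; rewrite eqn_leq X3 (leq_trans dx) // subset_leq_card.
  by split=> //; apply/eqP; rewrite eqEcard sub X3'.
have [v vB vX] : exists2 v, v \in B & v \notin X.
  by apply/subsetPn; apply/negP => /subset_leq_card; rewrite B4 leqNgt ltnS X3.
have [Nv eX3] := nX _ vB vX.
have [z zX zB] : exists2 z, z \in X & z \notin B.
  apply/subsetPn/negP => sub; have /card_gt2P[a [c [d [[aX cX dX] [ac cd da]]]]] : 2 < #|X| by
    rewrite eX3.
  have sk t : t \in X -> skel_edge v t.
    by move=> tX; apply: skB => //; [exact: (subsetP sub) | move: tX; rewrite -Nv inE].
  apply: (skel_degree2 k4 iso (x := v) (y1 := a) (y2 := c) (y3 := d)); auto.
  by rewrite !cons_uniq !inE negb_or ac cd eq_sym da.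
have zdeg x : x \in B -> x \notin X -> z -- x.
  by move=> xB xX; have [Nx _] := nX _ xB xX; move: zX; rewrite -Nx inE adj_sym.
have dz : #|nbr z| <= 2 by rewrite leqNgt; move: zB; rewrite BE.
have BX2 : #|B :\: X| <= 2.
  apply: leq_trans dz; apply: subset_leq_card; apply/subsetP => x; rewrite in_setD =>
    /andP[xX xB].
  by rewrite inE zdeg.
have BI2 : #|B :&: X| <= 2.
  have : #|B :&: X| < #|X|.
    apply: proper_card; apply/properP; split; first exact: subsetIr.
    by exists z; rewrite // in_setI (negbTE zB).
  by rewrite eX3.
have cB := cardsID X B.
have /card_gt1P[x [y [xB yB xy]]] : 1 < #|B :\: X| by move: cB BI2; rewrite B4; clear; lia.
have /card_gt1P[a [c [aB cB' ac]]] : 1 < #|B :&: X| by move: cB BX2; rewrite B4; clear; lia.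
move: xB yB aB cB'; rewrite !in_setD !in_setI =>
  /andP[xX xB] /andP[yX yB] /andP[aB aX] /andP[cB' cX].
have adjE u t : u \in B -> u \notin X -> t \in X -> t \in B -> skel_edge u t.
  by move=> uB uX tX tB; apply: skB => //; have [Nu _] := nX _ uB uX; move: tX; rewrite -Nu inE.
by apply: (skel_no_square k4 iso xy ac); apply: adjE.
Qed.

(** A vertex of degree three of the subdivision other than the hub is adjacent to the hub,
    which therefore has degree three in the skeleton. *)
Lemma K4sub_not_wheel r : ~ subgraph H (wheel r).
Proof.
move=> [h h_inj hM]; have [B [B4 BE _]] := K4sub_structure k4 KH; have [_ iso] := KH.
have skB x y : x \in B -> y \in B -> x -- y -> skel_edge x y.
  by rewrite !BE /skel_edge /= => -> -> ->.
have hub x : x \in B -> h x != None -> exists2 y, h y = None & x -- y.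
  case hx: (h x) => [i|//]; rewrite BE => dx _.
  case: (boolP [exists y, (h y == None) && (x -- y)]) => [/existsP[y /andP[/eqP hy xy]]|nh];
    first by exists y.
  exfalso; move: dx; rewrite leqNgt => /negP; apply; rewrite ltnS.
  rewrite -[degree x](card_imset (nbr x) h_inj).
  apply: (@leq_trans #|[set Some (ordS i); Some (ord_pred i)]|); last by rewrite cards2;
    case: (_ != _).
  apply: subset_leq_card; apply/subsetP => u /imsetP[y]; rewrite inE => xy ->.
  case hy: (h y) => [j|]; last first.
    by case/negP: nh; apply/existsP; exists y; rewrite hy xy.
  move: (hM _ _ xy); rewrite hx hy /= => /andP[_ /orP[/eqP->|/eqP->]]; rewrite !inE.
    by rewrite eqxx.
  by rewrite ordSK eqxx orbT.
have [y0 hy0] : exists y0, h y0 = None.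
  have [x xB hx] : exists2 x, x \in B & h x != None.
    have /card_gt1P[x [y [xB yB xy]]] : 1 < #|B| by rewrite B4.
    case hx: (h x) => [i|]; first by exists x; rewrite ?hx.
    by exists y => //; apply: contraNneq xy => hy; apply/eqP/h_inj; rewrite hx hy.
  by have [y hy _] := hub _ xB hx; exists y.
have adj0 x : x \in B :\ y0 -> y0 -- x.
  rewrite !inE => /andP[xy xB]; have [|y hy xy'] := hub x xB.
    by apply: contraNneq xy => hx; apply/eqP/h_inj; rewrite hx.
  by rewrite adj_sym -(h_inj y y0) // hy.
have /card_gt2P[a [c [d [[aB cB dB] [ac cd da]]]]] : 2 < #|B :\ y0|.
  by have := cardsD1 y0 B; rewrite B4; case: (_ \in _); clear; lia.
have y0B : y0 \in B.
  by rewrite BE; apply/card_gt2P; exists a, c, d; rewrite !inE !adj0.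
apply: (skel_degree2 k4 iso (x := y0) (y1 := a) (y2 := c) (y3 := d)).
  by rewrite !cons_uniq !inE negb_or ac cd eq_sym da.
all: apply: skB; rewrite ?adj0 //.
all: by [move: aB; rewrite inE => /andP[]|move: cB; rewrite inE => /andP[]|move: dB;
  rewrite inE => /andP[]].
Qed.

(** Every edge of [G] at a branch vertex belongs to the subdivision. So does, then, the
    triangle at a branch vertex [x] with two branch neighbours: it contains one of them, and
    its third vertex gives a triangle in the skeleton or a second connection. *)
Lemma K4sub_not_truncated G : truncated_cubic G -> ~ subgraph H G.
Proof.
move=> [cub tri] [f f_inj fM]; have [B [B4 BE noby]] := K4sub_structure k4 KH;
  have [_ iso] := KH.
have skB x y : x \in B -> y \in B -> x -- y -> skel_edge x y.
  by rewrite !BE /skel_edge /= => -> -> ->.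
have nbE x : x \in B -> f @: nbr x = nbr (f x) /\ #|nbr x| = 3.
  rewrite BE => dx; have [sub cE] := degree_inj x f_inj fM.
  have E : f @: nbr x = nbr (f x) by apply/eqP; rewrite eqEcard sub cE;
    rewrite -/(degree (f x)) cub.
  by split=> //; rewrite -/(degree x) -cE E; apply: cub.
have back x y : x \in B -> f x -- f y -> x -- y.
  move=> xB fxy; have [E _] := nbE _ xB.
  have : f y \in f @: nbr x by rewrite E inE.
  by rewrite mem_imset // inE.
have [x [a [c [ac xa xc]]]] := skel_inner iso k3.
have [xa' xB aB] : [/\ x -- a, x \in B & a \in B] by move: xa; rewrite !BE /skel_edge /= =>
  /and3P[].
have [xc' _ cB] : [/\ x -- c, x \in B & c \in B] by move: xc; rewrite !BE /skel_edge /= =>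
  /and3P[].
have /eqP/cards1P[T TE] := tri (f x).
have : T \in [set T : {set G} | triangle T & f x \in T] by rewrite TE set11.
rewrite inE => /andP[tT xT]; have [w1 [w2 [_ xw1 xw2 w12]]] := triangleP tT xT.
have [Ex nx] := nbE _ xB.
have lift w : f x -- w -> exists2 y, x -- y & w = f y.
  move=> xw; have : w \in f @: nbr x by rewrite Ex inE.
  by case/imsetP=> y; rewrite inE => xy ->; exists y.
have [y1 xy1 E1] := lift _ xw1; have [y2 xy2 E2] := lift _ xw2; subst w1 w2.
have key u v : u \in B -> x -- u -> x -- v -> f u -- f v -> False.
  move=> uB xu xv fuv; have uv := back _ _ uB fuv.
  case: (boolP (v \in B)) => vB.
    apply: (skel_no_triangle k4 iso (x := x) (y := u) (z := v)); apply: skB => //;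
      by rewrite adj_sym.
  by apply: (noby x u v) => //; rewrite adj_sym.
case: (boolP (y1 \in B)) => y1B; first exact: key xy2 w12.
case: (boolP (y2 \in B)) => y2B; first by apply: (key y2 y1) => //; rewrite adj_sym.
have : uniq [:: y1; y2; a; c].
  have ny u v : u \notin B -> v \in B -> u != v by move=> uB vB; apply: contraNneq uB => ->.
  have y12 : y1 != y2 by apply: contraTneq w12 => ->; rewrite adj_irrefl.
  by rewrite !cons_uniq !inE !negb_or ac y12 (ny y1 a) // (ny y1 c) // (ny y2 a) // (ny y2 c).
move/card_uniqP => E4; have : #|[:: y1; y2; a; c]| <= #|nbr x|.
  by apply: subset_leq_card; apply/subsetP => z; rewrite !inE => /or4P[]/eqP->.
by rewrite E4 nx.
Qed.

End Forbidden.

Lemma subgraph_trans G1 G2 G3 : subgraph G1 G2 -> subgraph G2 G3 -> subgraph G1 G3.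
Proof.
move=> [f fi fM] [g gi gM]; exists (g \o f); first exact: inj_comp.
by move=> x y /fM /gM.
Qed.

Lemma isomorphic_subgraph G1 G2 : isomorphic G1 G2 -> subgraph G1 G2.
Proof. by move=> [f /bij_inj fi fM]; exists f => // x y; rewrite fM. Qed.

Lemma classification_asp (G : sgraph) :
  [\/ #|G| <= 6, K3r_type G, exists r : nat,
    6 <= r /\ isomorphic G (wheel r) | truncated_cubic G] ->
  ASP G.
Proof.
move=> cls H KH sHG; have [k [k3 k4 {}KH]] : exists k, [/\ 3 <= k, k <= 4 & K4sub (pathg k) H].
  by case: KH; [exists 3 | exists 4].
case: cls => [le6|[r [_ _ sGD]]|[r [_ /isomorphic_subgraph sGW]]|tr].
- have [f fi _] := sHG; by have := leq_trans (K4sub_card k4 KH) (leq_card f fi);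
  rewrite ltnNge le6.
- exact: (K4sub_not_D k4 KH (subgraph_trans sHG sGD)).
- exact: (K4sub_not_wheel k4 KH (subgraph_trans sHG sGW)).
- exact: (K4sub_not_truncated k3 k4 KH tr sHG).
Qed.

(** * Chromatic numbers *)

Lemma colorableP (G : sgraph) k :
  colorable G k <-> exists f : G -> 'I_k, forall x y, x -- y -> f x != f y.
Proof.
split=> [/existsP[f /forallP fP]|[f fP]].
  by exists f => x y; have /forallP/(_ y)/implyP := fP x.
apply/existsP; exists [ffun x => f x]; apply/forallP => x; apply/forallP => y.
by apply/implyP => xy; rewrite !ffunE fP.
Qed.

Lemma chi_colorable (G : sgraph) : colorable G (chi G).
Proof. by rewrite /chi; case: ex_minnP. Qed.

Lemma chi_min (G : sgraph) k : colorable G k -> chi G <= k.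
Proof. by rewrite /chi; case: ex_minnP => m _; apply. Qed.

Lemma colorable_subgraph (H G : sgraph) k : subgraph H G -> colorable G k -> colorable H k.
Proof.
move=> [f _ fM] /colorableP[g gP]; apply/colorableP; exists (g \o f) => x y /fM; exact: gP.
Qed.

Lemma chi_edge (G : sgraph) (x y : G) : x -- y -> 2 <= chi G.
Proof.
move=> xy; have /colorableP[f fP] := chi_colorable G.
have U : uniq [:: f x; f y] by rewrite !cons_uniq !inE fP.
by have := max_card (mem [:: f x; f y]); rewrite (card_uniqP U) card_ord.
Qed.

Lemma chi_triangle (G : sgraph) (x y z : G) : x -- y -> x -- z -> y -- z -> 3 <= chi G.
Proof.
move=> xy xz yz; have /colorableP[f fP] := chi_colorable G.
have U : uniq [:: f x; f y; f z] by rewrite !cons_uniq !inE negb_or !fP.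
by have := max_card (mem [:: f x; f y; f z]); rewrite (card_uniqP U) card_ord.
Qed.

Lemma D_colorable r : colorable (D r) 4.
Proof.
apply/colorableP; exists (fun x : D r => match x with inl i =>
  widen_ord (isT : 3 <= 4) i | inr _ => ord_max end).
move=> [i|j] [i'|j'] //= ii'; rewrite -val_eqE //=.
- by rewrite ltn_eqF.
- by rewrite gtn_eqF.
Qed.

Lemma wheel_colorable r : 3 <= r -> colorable (wheel r) 4.
Proof.
move=> r3; apply/colorableP.
(* The rim alternates between two colours, with a third one on its last vertex. *)
pose col (i : nat) : 'I_4 := if i == r.-1 then inord 2 else if odd i then inord 1 else inord 0.
have step i : i < r -> col i != col (i.+1 %% r).
  move=> ir; rewrite /col; case: (eqVneq i r.-1) => [->|ni].
    rewrite prednK ?(ltn_trans _ r3) // modnn (ltn_eqF (_ : 0 < r.-1)) /=; last by move: r3;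
      clear; lia.
    by rewrite -val_eqE /= !inordK.
  rewrite modn_small; last by move: ir ni; clear; lia.
  by case: (eqVneq i.+1 r.-1) => _ /=; case: (odd i); rewrite -val_eqE /= !inordK.
have col3 i : col i != inord 3.
  by rewrite /col; case: ifP => _; [|case: ifP => _]; rewrite -val_eqE /= !inordK.
exists (fun x : wheel r => if x is Some i then col i else inord 3).
case=> [i|] [j|] //= => [/andP[_ /orP[]/eqP->]|_].
- exact: step.
- by rewrite eq_sym step.
- by rewrite eq_sym col3.
Qed.

Section Brooks.
Variable G : sgraph.
Hypotheses (G3 : k_connected 3 G) (cub : cubic G).

Let extends (U : {set G}) (a c : G) := forall f : G -> 'I_3, f a = f c ->
  (forall x y, x \notin U -> y \notin U -> x -- y -> f x != f y) -> colorable G 3.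

Lemma free_color (f : G -> 'I_3) (A : {set G}) : #|A| <= 2 -> exists k, forall x, x \in A ->
  f x != k.
Proof.
move=> A2; have : ~: (f @: A) != set0.
  rewrite -card_gt0; have := cardsC (f @: A); rewrite card_ord.
  by have := leq_imset_card f A; move: A2; clear; lia.
by case/set0Pn=> k; rewrite inE => kA; exists k => x xA; apply: contraNneq kA => <-;
  apply: imset_f.
Qed.

(** A vertex with at most two coloured neighbours is coloured next, whatever their colours. *)
Lemma extends_recolor (U : {set G}) (v a c : G) (f : G -> 'I_3) (A : {set G}) : #|A| <= 2 ->
    (forall y, v -- y -> y \notin U -> y \in A) ->
    (forall x y, x \notin v |: U -> y \notin v |: U -> x -- y -> f x != f y) ->
  exists2 g : G -> 'I_3, forall x, x != v -> g x = f x &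
    forall x y, x \notin U -> y \notin U -> x -- y -> g x != g y.
Proof.
move=> A2 NA fP; have [k kP] := free_color f A2.
exists (fun x => if x == v then k else f x) => [x /negbTE->//|x y xU yU xy].
case: (eqVneq x v) => [xv|xv]; case: (eqVneq y v) => [yv|yv].
- by rewrite xv yv adj_irrefl in xy.
- by rewrite eq_sym kP // NA // -xv.
- by rewrite kP // NA // -yv adj_sym.
- by apply: fP; rewrite // !inE negb_or ?xv ?yv.
Qed.

(** The proof of the theorem of Brooks: colour [a] and [c] alike, and then the other
    vertices, each before the neighbour through which it is connected to [b]. Every vertex
    but [b] has at most two coloured neighbours when its turn comes, and [b] sees [a] and
    [c] in the same colour. The set [U] of vertices still to be coloured is grown from [b]. *)
Lemma cubic_3colorable (b a c : G) : b -- a -> b -- c -> a != c -> ~~ (a -- c) -> colorable G 3.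
Proof.
move=> ba bc ac nac.
have ext0 : extends [set b] a c.
  move=> f fac fP; pose A := nbr b :\ c.
  have A2 : #|A| <= 2 by have := cardsD1 c (nbr b); rewrite inE bc -/(degree b) cub /A; clear;
    lia.
  have [k kP] := free_color f A2.
  apply/colorableP; exists (fun x => if x == b then k else f x) => x y xy.
  have kN z : b -- z -> f z != k.
    move=> bz; case: (eqVneq z c) => [->|zc]; last by apply: kP; rewrite !inE zc.
    by rewrite -fac; apply: kP; rewrite !inE ac.
  case: (eqVneq x b) => [xb|xb]; case: (eqVneq y b) => [yb|yb].
  - by rewrite xb yb adj_irrefl in xy.
  - by rewrite eq_sym kN // -xb.
  - by rewrite kN // -yb adj_sym.
  - by apply: fP; rewrite // inE.
suff grow n : forall U : {set G}, #|~: U| < n -> b \in U -> a \notin U -> c \notin U ->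
  extends U a c -> colorable G 3.
  have nb x : b -- x -> x \notin [set b] by move=> bx; rewrite inE; apply: contraTneq bx => ->;
    rewrite adj_irrefl.
  by apply: (grow #|~: [set b]|.+1 [set b]); rewrite ?nb ?set11.
elim: n => // n IHn U ltn bU aU cU extU.
case: (boolP (~: U \subset [set a; c])) => [sub|/subsetPn[v vU vac]].
  apply: (extU (fun _ => ord0)) => // x y xU yU xy.
  have inac z : z \notin U -> (z == a) || (z == c).
    by move=> zU; have := subsetP sub z; rewrite !inE zU => /(_ isT).
  move: xy; case/orP: (inac _ xU) => /eqP->; case/orP: (inac _ yU) => /eqP-> => h;
    rewrite ?adj_irrefl // in h.
    by rewrite h in nac.
  by rewrite adj_sym h in nac.
rewrite inE in vU.
pose S := [pred z | z \in U]; pose T := [pred z | z \notin U].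
have [||||u [r [w [uU wU Lr _ [_ wA rP]]]]] := @bridge3 G [set a; c] S T b v G3 _ bU vU.
- by rewrite cards2; case: (_ != _).
- by rewrite !inE negb_or; apply/andP; split; [move: ba|move: bc]; apply: contraTneq => ->;
  rewrite adj_irrefl.
- exact: vac.
- by move=> z zU; rewrite /T /= negbK.
have r0 : r = [::].
  by case: r rP {Lr} => // x r /(_ x (mem_head _ _)) /and3P[]; rewrite /S /T /= => /negbTE->.
move: Lr; rewrite r0 link_nil => uw.
rewrite /S /T /= in uU wU.
apply: (IHn (w |: U)).
- apply: leq_trans (_ : #|~: U| <= n) => //; apply: proper_card; apply/properP; split.
    by apply/subsetP => z; rewrite !inE negb_or => /andP[].
  by exists w; rewrite !inE // eqxx.
- by rewrite inE bU orbT.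
- by move: wA; rewrite !inE !negb_or aU eq_sym => /andP[->].
- by move: wA; rewrite !inE !negb_or cU (eq_sym c) => /andP[_ ->].
move=> f fac fP.
have [|y wy yU|x y xU yU xy|g gE gP] := @extends_recolor U w a c f (nbr w :\ u).
- have := cardsD1 u (nbr w); rewrite inE adj_sym uw -/(degree w) cub; clear; lia.
- by rewrite !inE wy andbT; apply: contraNneq yU => ->.
- exact: fP.
apply: (extU g) => //; move: wA; rewrite !inE negb_or => /andP[wa wc].
by rewrite !gE // eq_sym.
Qed.

End Brooks.

(** A neighbour of [b] in its triangle and one outside are not adjacent, which is what
    [cubic_3colorable] asks for. *)
Lemma truncated_chi (G : sgraph) : k_connected 3 G -> truncated_cubic G -> chi G = 3.
Proof.
move=> G3 [cub tri].
have [b _] : exists b : G, b \in setT.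
  by apply/set0Pn; rewrite -card_gt0 cardsT; case: G3 => /(ltn_trans _)->.
have /eqP/cards1P[T TE] := tri b.
have : T \in [set T : {set G} | triangle T & b \in T] by rewrite TE set11.
rewrite inE => /andP[tT bT]; have [u [v [ET bu bv uv]]] := triangleP tT bT.
apply/eqP; rewrite eqn_leq (chi_triangle bu bv uv) andbT; apply: chi_min.
have vu : v != u by apply: contraTneq uv => ->; rewrite adj_irrefl.
have [w] : exists w, w \in (nbr b :\ u) :\ v.
  apply/set0Pn; rewrite -card_gt0; have := cardsD1 u (nbr b); have := cardsD1 v (nbr b :\ u).
  by rewrite -[#|nbr b|]/(degree b) cub !inE bu bv vu; clear; lia.
rewrite !inE => /and3P[wv wu bw].
apply: (cubic_3colorable G3 cub bu bw); first by rewrite eq_sym.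
apply/negP => uw; have : [set b; u; w] \in [set T].
  by rewrite -TE inE triangle3 // !inE eqxx.
rewrite inE ET => /eqP/setP/(_ w); rewrite !inE eqxx orbT (negbTE wu) (negbTE wv) !orbF.
by move/esym/eqP => wb; rewrite wb adj_irrefl in bw.
Qed.

Theorem theorem1p2 (G : sgraph) (G3c : k_connected 3 G) :
  (ASP G <->
     [\/ #|G| <= 6,
         exists r : nat, [/\ 4 <= r, subgraph (K3 r) G & subgraph G (D r)],
         exists r : nat, 6 <= r /\ isomorphic G (wheel r)
       | truncated_cubic G]) /\
  [/\ #|G| <= 6 -> 2 <= chi G <= 6,
      forall r : nat, 4 <= r -> subgraph (K3 r) G -> subgraph G (D r) ->
        2 <= chi G <= 4,
      forall r : nat, 6 <= r -> isomorphic G (wheel r) -> 3 <= chi G <= 4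
    & truncated_cubic G -> chi G = 3].
Proof.
split; first by split; [exact: asp_classification | exact: classification_asp].
have chi2 : 2 <= chi G.
  have [b _] : exists b : G, b \in setT.
    by apply/set0Pn; rewrite -card_gt0 cardsT; case: G3c => /(ltn_trans _)->.
  have [y] : exists y, y \in nbr b by apply/set0Pn;
    rewrite -card_gt0 (leq_trans _ (min_degree G3c b)).
  by rewrite inE; apply: chi_edge.
split.
- by move=> G6; rewrite chi2; apply: leq_trans G6; apply: chi_min; apply: colorable_card.
- by move=> r _ _ sub; rewrite chi2; apply/chi_min/(colorable_subgraph sub)/D_colorable.
- move=> r r6 iso; apply/andP; split.
    have [f [g fK gK] fM] := iso.
    have r0 : 0 < r by apply: leq_trans r6.
    pose i0 : 'I_r := Ordinal r0; pose i1 : 'I_r := Ordinal (leq_trans (isT : 1 < 6) r6).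
    have gM x y : g x -- g y = x -- y by rewrite -fM !gK.
    apply: (@chi_triangle G (g None) (g (Some i0)) (g (Some i1))); rewrite gM //=.
    by rewrite -[i1 == _]val_eqE /= modn_small // (leq_trans _ r6).
  apply/chi_min/(colorable_subgraph (isomorphic_subgraph iso))/wheel_colorable.
  exact: leq_trans r6.
- exact: truncated_chi.
Qed.
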